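(* Let $D\in M_{k\times l}(\mathbb{R})$ be a non-branching matrix without zero columns. Then there exist matrices $R\in M_{k\times l}(\mathbb{R})$ and $V\in M_{l\times l}(\mathbb{R})$, computable from $D$ in $O(k\cdot\alpha(l)+l)$ arithmetic operations, such that $R=DV$ and: (1) $V$ is upper-triangular with entries in $\{-1,0,1\}$; (2) the non-zero columns of $R$ are linearly independent; (3) the supports of those columns of $V$ that have more than one non-zero entry are pairwise disjoint; (4) these columns correspond precisely to the zero columns of $R$, i.e. for every $i$, the $i$-th column of $V$ has more than one non-zero entry if and only if the $i$-th column of $R$ is zero.
   Context: A real matrix is non-branching if all its entries lie in $\{-1,0,1\}$ and every row contains at most two non-zero entries. The support of a vector is the set of indices of its non-zero entries. $\alpha(\cdot)$ denotes the inverse Ackermann function. The input matrix $D$ is given in a sparse format (compressed sparse row), so that the non-zero entries of a row can be read off in constant time; matrices are likewise output in sparse form. *)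

(* Defs.v *)
From mathcomp Require Import all_boot all_order all_algebra reals.

Set Implicit Arguments.
Unset Strict Implicit.
Unset Printing Implicit Defensive.

Import Order.TTheory GRing.Theory Num.Theory.
Local Open Scope ring_scope.

Section Matrices.
Variable R : realType.

Definition non_branching k l (D : 'M[R]_(k, l)) : Prop :=
  (forall i j, D i j \in [:: -1; 0; 1]) /\
  (forall i, #|[set j | D i j != 0%R]| <= 2)%N.

Definition supp n (v : 'cV[R]_n) : {set 'I_n} := [set i | v i 0 != 0].

Definition upper_triangular n (V : 'M[R]_n) : Prop :=
  forall i j : 'I_n, (j < i)%N -> V i j = 0.

Definition nonzero_columns k l (A : 'M[R]_(k, l)) : seq 'cV[R]_k :=
  [seq col j A | j <- enum 'I_l & col j A != 0].

(* Compressed sparse row: row i of A is stored in the cells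
   ptr i, ..., ptr i.+1 - 1 of idx (column indices) and val (entries).  Only
   non-zero entries are stored, each one once, in any order within a row.
   Nothing is said of the cells beyond ptr k.  *)
Definition is_csr k l (A : 'M[R]_(k, l))
    (ptr idx : nat -> nat) (val : nat -> R) : Prop :=
  [/\ ptr 0%N = 0%N,
      forall i, (i < k)%N -> (ptr i <= ptr i.+1)%N,
      forall i, (i < k)%N -> uniq [seq idx t | t <- index_iota (ptr i) (ptr i.+1)],
      forall t, (t < ptr k)%N -> (idx t < l)%N /\ val t != 0
    & forall (i : 'I_k) (j : 'I_l),
        A i j = \sum_(ptr i <= t < ptr i.+1 | idx t == j) val t].

End Matrices.

Fixpoint ackermann (m : nat) : nat -> nat :=
  match m with
  | 0 => S
  | m'.+1 => fix ack_m n :=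
      match n with
      | 0 => ackermann m' 1
      | n'.+1 => ackermann m' (ack_m n')
      end
  end.

Lemma ltn_ackermann m n : (n < ackermann m n)%N.
Proof.
elim: m n => [|m IHm] //; elim=> [|n IHn].
  exact: ltn_trans (IHm 1).
exact: leq_ltn_trans IHn (IHm _).
Qed.

Lemma inv_ackermann_subproof l :
  exists m, (0 < m)%N && (l <= ackermann m m)%N.
Proof.
exists l.+1; apply/andP; split=> //.
exact: ltnW (ltnW (ltn_ackermann l.+1 l.+1)).
Qed.

(* The least m >= 1 with A(m, m) >= l.  The lower bound 1 is the usual
   convention: it keeps O(k * alpha l) from being O(0) for tiny l.  *)
Definition inv_ackermann (l : nat) : nat := ex_minn (inv_ackermann_subproof l).

(* A unit-cost real RAM.  The memory consists of index variables, arrays of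
   indices and arrays of reals.  Indices can only be compared, added and
   subtracted, and real numbers can not be converted into indices.
   The syntax does not mention R: a program is a finite object, which is fixed
   before the size and the entries of its input.  *)
Inductive iexp : Type :=
| Cst of nat
| Var of nat
| IGet of nat & iexp          (* IGet a e: cell e of index array a *)
| IAdd of iexp & iexp
| ISub of iexp & iexp.        (* truncated at 0 *)

Inductive rexp : Type :=
| One
| RGet of nat & iexp
| RAdd of rexp & rexp
| RSub of rexp & rexp
| RMul of rexp & rexp
| RDiv of rexp & rexp.        (* x / 0 = 0 *)

Inductive test : Type :=
| IEq of iexp & iexp
| ILt of iexp & iexp
| REq of rexp & rexp
| RLt of rexp & rexp
| Not of test
| And of test & test.

Inductive prog : Type :=
| Skip
| Assign of nat & iexp
| ISet of nat & iexp & iexp   (* ISet a e f: cell e of index array a := f *)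
| RSet of nat & iexp & rexp
| Seq of prog & prog
| If of test & prog & prog
| While of test & prog.

Section Semantics.
Variable R : realType.

Record state := State {
  ivar : nat -> nat;
  iarr : nat -> nat -> nat;
  rarr : nat -> nat -> R
}.

Definition upd (T : Type) (f : nat -> T) (x : nat) (v : T) : nat -> T :=
  fun y => if y == x then v else f y.

Fixpoint ieval (s : state) (e : iexp) : nat :=
  match e with
  | Cst n => n
  | Var x => ivar s x
  | IGet a e => iarr s a (ieval s e)
  | IAdd e f => (ieval s e + ieval s f)%N
  | ISub e f => (ieval s e - ieval s f)%N
  end.

Fixpoint reval (s : state) (e : rexp) : R :=
  match e with
  | One => 1
  | RGet a e => rarr s a (ieval s e)
  | RAdd e f => reval s e + reval s f
  | RSub e f => reval s e - reval s f
  | RMul e f => reval s e * reval s f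
  | RDiv e f => reval s e / reval s f
  end.

Fixpoint teval (s : state) (b : test) : bool :=
  match b with
  | IEq e f => ieval s e == ieval s f
  | ILt e f => (ieval s e < ieval s f)%N
  | REq e f => reval s e == reval s f
  | RLt e f => reval s e < reval s f
  | Not b => ~~ teval s b
  | And b c => teval s b && teval s c
  end.

(* Every node of an expression counts as one operation, be it arithmetic on
   reals or on indices, a comparison or a memory access.  *)
Fixpoint icost (e : iexp) : nat :=
  match e with
  | Cst _ | Var _ => 1
  | IGet _ e => (icost e).+1
  | IAdd e f | ISub e f => (icost e + icost f).+1
  end.

Fixpoint rcost (e : rexp) : nat :=
  match e with
  | One => 1
  | RGet _ e => (icost e).+1
  | RAdd e f | RSub e f | RMul e f | RDiv e f => (rcost e + rcost f).+1
  end.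

Fixpoint tcost (b : test) : nat :=
  match b with
  | IEq e f | ILt e f => (icost e + icost f).+1
  | REq e f | RLt e f => (rcost e + rcost f).+1
  | Not b => (tcost b).+1
  | And b c => (tcost b + tcost c).+1
  end.

(* exec c s n s': started in s, the program c halts in s' after n operations. *)
Inductive exec : prog -> state -> nat -> state -> Prop :=
| ExecSkip s : exec Skip s 1 s
| ExecAssign x e s :
    exec (Assign x e) s (icost e).+1
      (State (upd (ivar s) x (ieval s e)) (iarr s) (rarr s))
| ExecISet a e f s :
    exec (ISet a e f) s (icost e + icost f).+1
      (State (ivar s)
             (upd (iarr s) a (upd (iarr s a) (ieval s e) (ieval s f)))
             (rarr s))
| ExecRSet a e f s :
    exec (RSet a e f) s (icost e + rcost f).+1
      (State (ivar s) (iarr s)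
             (upd (rarr s) a (upd (rarr s a) (ieval s e) (reval s f))))
| ExecSeq c d s s' s'' m n :
    exec c s m s' -> exec d s' n s'' -> exec (Seq c d) s (m + n).+1 s''
| ExecIfTrue b c d s s' n :
    teval s b -> exec c s n s' -> exec (If b c d) s (tcost b + n).+1 s'
| ExecIfFalse b c d s s' n :
    ~~ teval s b -> exec d s n s' -> exec (If b c d) s (tcost b + n).+1 s'
| ExecWhileTrue b c s s' s'' m n :
    teval s b -> exec c s m s' -> exec (While b c) s' n s'' ->
    exec (While b c) s (tcost b + m + n).+1 s''
| ExecWhileFalse b c s :
    ~~ teval s b -> exec (While b c) s (tcost b).+1 s.

(* Input: the dimensions in index variables 0 and 1, the CSR representation of
   the matrix in index arrays 0 and 1 and real array 0, and 0 elsewhere.  *)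
Definition input (k l : nat) (ptr idx : nat -> nat) (val : nat -> R) : state :=
  State (fun x => nth 0%N [:: k; l] x)
        (fun a => nth (fun=> 0%N) [:: ptr; idx] a)
        (fun a => nth (fun=> 0) [:: val] a).

(* Output: the CSR representations of A (index arrays 2 and 3, real array 1)
   and of B (index arrays 4 and 5, real array 2).  *)
Definition output k l m n (A : 'M[R]_(k, l)) (B : 'M[R]_(m, n)) (s : state) :
    Prop :=
  is_csr A (iarr s 2) (iarr s 3) (rarr s 1) /\
  is_csr B (iarr s 4) (iarr s 5) (rarr s 2).

(* Whichever CSR representation of D is given, c computes A and B from it in at
   most t operations.  *)
Definition computes (c : prog) k l m n (D : 'M[R]_(k, l))
    (A : 'M[R]_(k, l)) (B : 'M[R]_(m, n)) (t : nat) : Prop :=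
  forall ptr idx val, is_csr D ptr idx val ->
  exists u s, [/\ exec c (input k l ptr idx val) u s, (u <= t)%N & output A B s].

End Semantics.

(* Main.v *)
Require Import Defs.
From mathcomp Require Import all_boot all_order all_algebra reals.
From mathcomp Require Import zify.

Set Implicit Arguments.
Unset Strict Implicit.
Unset Printing Implicit Defensive.

Import Order.TTheory GRing.Theory Num.Theory.
Local Open Scope ring_scope.

(** A kernel vector [y] of a non-branching matrix [D] vanishes at the column of
    each row with a single non-zero entry, and satisfies [y i = y j] or
    [y i = - y j] for each row with two non-zero entries, in the columns [i] and
    [j].  View the columns as vertices and the rows as signed edges: on a
    connected component, [y] is determined by its value at the largest column
    [m], up to signs [x], which can be read off along walks from [m].  The component is
    balanced if these signs satisfy all of its row equations.  If so, they form
    a kernel vector, and otherwise [y] vanishes on the component.  Let the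
    [m]-th column of [V] be this kernel vector when [m] is the largest column of
    a balanced component, and let all other columns of [V] be unit vectors.
    Then [D *m V] is [D] with the columns [m] zeroed, and its other columns are
    independent, as a relation between them is a kernel vector without entries
    in the columns [m].  Since [D] has no zero column, a balanced component has
    at least two columns, which gives the equivalence of the last two
    properties ([card_supp_reduction], [reduction_free]).

    The components and signs are found in time [O(k + l)] by a breadth-first
    search, because a sparse matrix with two entries per row has at most [2 * k]
    cells.  The inverse Ackermann function is positive, so that this is
    within the required bound, and a union-find structure can be dispensed with.
    Columns are tried as starting points from the last to the first; in this
    way each class is named by its largest member.  The program is a sequence of
    loops with loop-free bodies.  Such a body is a function on states ([run]),
    a loop is handled by an invariant and a measure ([runs_while]), and its cost
    is a constant times the size of the input when the measure starts below
    twice that size.  The measure of the search ([potential]) counts the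
    starting points, the columns and the cells that still have to be treated.

    The matrix [V] has to be named before the storage of [D] is known, whereas
    the order of the search depends on that storage.  This is no obstacle, as [V]
    only depends on the kernel: the kernel vectors among its columns are the
    reduced echelon basis of the kernel ([reduction_unique]).  *)

(** * Total correctness and cost of programs without nested loops *)

Fixpoint loopfree (c : prog) : bool :=
  match c with
  | Seq c d | If _ c d => loopfree c && loopfree d
  | While _ _ => false
  | _ => true
  end.

(** The price of [c] per unit of input size [M], when every loop of [c] makes at
    most [2 * M] turns.  For a loop-free program it is an absolute bound.  A loop
    evaluates its test once more than its body, hence at most [3 * M] times.  *)
Fixpoint unit_cost (c : prog) : nat :=
  match c with
  | Skip => 1
  | Assign _ e => (icost e).+1
  | ISet _ e f => (icost e + icost f).+1
  | RSet _ e f => (icost e + rcost f).+1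
  | Seq c d => (unit_cost c + unit_cost d).+1
  | If b c d => (tcost b + (unit_cost c + unit_cost d)).+1
  | While b c => 3 * (tcost b + unit_cost c).+1
  end.

Fixpoint sets_ivar (c : prog) (x : nat) : bool :=
  match c with
  | Assign y _ => x == y
  | Seq c d | If _ c d => sets_ivar c x || sets_ivar d x
  | While _ c => sets_ivar c x
  | _ => false
  end.

Fixpoint sets_iarr (c : prog) (a : nat) : bool :=
  match c with
  | ISet b _ _ => a == b
  | Seq c d | If _ c d => sets_iarr c a || sets_iarr d a
  | While _ c => sets_iarr c a
  | _ => false
  end.

Fixpoint sets_rarr (c : prog) (a : nat) : bool :=
  match c with
  | RSet b _ _ => a == b
  | Seq c d | If _ c d => sets_rarr c a || sets_rarr d a
  | While _ c => sets_rarr c a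
  | _ => false
  end.

Definition For (x : nat) (e : iexp) (c : prog) : prog :=
  Seq (Assign x (Cst 0))
      (While (ILt (Var x) e) (Seq c (Assign x (IAdd (Var x) (Cst 1))))).

Section Calculus.
Variable R : realType.
Implicit Types (s : state R) (c d : prog) (I : state R -> Prop).

Fixpoint run c s : state R :=
  match c with
  | Skip | While _ _ => s
  | Assign x e => State (upd (ivar s) x (ieval s e)) (iarr s) (rarr s)
  | ISet a e f =>
      State (ivar s) (upd (iarr s) a (upd (iarr s a) (ieval s e) (ieval s f)))
            (rarr s)
  | RSet a e f =>
      State (ivar s) (iarr s)
            (upd (rarr s) a (upd (rarr s a) (ieval s e) (reval s f)))
  | Seq c d => run d (run c s)
  | If b c d => if teval s b then run c s else run d s
  end.

Lemma exec_run c s :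
  loopfree c -> exists2 u, exec c s u (run c s) & (u <= unit_cost c)%N.
Proof.
elim: c s => [|x e|a e f|a e f|c IHc d IHd|b c IHc d IHd|b c _] s //=.
- by move=> _; exists 1%N; [constructor|].
- by move=> _; eexists; [constructor|].
- by move=> _; eexists; [constructor|].
- by move=> _; eexists; [constructor|].
- case/andP=> /(IHc s) [u eu lu] /(IHd (run c s)) [v ev lv].
  by exists (u + v).+1; [apply: ExecSeq eu ev | lia].
- case/andP=> /(IHc s) [u eu lu] /(IHd s) [v ev lv].
  case: ifPn => sb.
    by exists (tcost b + u).+1; [apply: ExecIfTrue | lia].
  by exists (tcost b + v).+1; [apply: ExecIfFalse | lia].
Qed.

Definition preserves c s s' : Prop :=
  [/\ forall x, ~~ sets_ivar c x -> ivar s' x = ivar s x,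
      forall a, ~~ sets_iarr c a -> iarr s' a = iarr s a
    & forall a, ~~ sets_rarr c a -> rarr s' a = rarr s a].

Lemma preserves_refl c s : preserves c s s.
Proof. by []. Qed.

Lemma preserves_trans c s s' s'' :
  preserves c s s' -> preserves c s' s'' -> preserves c s s''.
Proof.
case=> v1 i1 r1 [v2 i2 r2]; split=> x nx.
- by rewrite v2 // v1.
- by rewrite i2 // i1.
- by rewrite r2 // r1.
Qed.

Lemma preserves_weak c d s s' :
  (forall x, sets_ivar d x -> sets_ivar c x) ->
  (forall x, sets_iarr d x -> sets_iarr c x) ->
  (forall x, sets_rarr d x -> sets_rarr c x) ->
  preserves d s s' -> preserves c s s'.
Proof.
move=> dv di dr [v i r]; split=> x nx; [apply: v|apply: i|apply: r].
- by apply: contra nx; apply: dv.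
- by apply: contra nx; apply: di.
- by apply: contra nx; apply: dr.
Qed.

Lemma run_preserves c s : preserves c s (run c s).
Proof.
elim: c s => [|x e|a e f|a e f|c IHc d IHd|b c IHc d IHd|b c _] s //=.
- by split=> //= y /negbTE ny; rewrite /upd ny.
- by split=> //= y /negbTE ny; rewrite /upd ny.
- by split=> //= y /negbTE ny; rewrite /upd ny.
- by apply: (@preserves_trans _ s (run c s));
    [apply: preserves_weak (IHc s)|apply: preserves_weak (IHd _)];
    move=> x /= ->; rewrite ?orbT.
- by case: ifP => _; [apply: preserves_weak (IHc s)|apply: preserves_weak (IHd _)];
    move=> x /= ->; rewrite ?orbT.
Qed.

(** Total correctness within a cost that is linear in [M], the size of the
    input.  What [c] does not assign is recorded as unchanged, so that [Q] need
    not repeat it.  *)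
Definition runs M c s (Q : state R -> Prop) : Prop :=
  exists u s',
    [/\ exec c s u s', (u <= unit_cost c * M)%N, preserves c s s' & Q s'].

Lemma runs_conseq M c s (P Q : state R -> Prop) :
  (forall s', P s' -> Q s') -> runs M c s P -> runs M c s Q.
Proof. by move=> PQ [u [s' [eu lu pu /PQ Qs]]]; exists u, s'. Qed.

Lemma runs_loopfree M c s (Q : state R -> Prop) :
  (0 < M)%N -> loopfree c -> Q (run c s) -> runs M c s Q.
Proof.
move=> M0 lc Qs; have [u eu lu] := exec_run s lc.
exists u, (run c s); split=> //; last exact: run_preserves.
by apply: leq_trans lu _; rewrite leq_pmulr.
Qed.

Lemma runs_seq M c d s (P Q : state R -> Prop) :
  (0 < M)%N -> runs M c s P ->
  (forall s', preserves c s s' -> P s' -> runs M d s' Q) -> runs M (Seq c d) s Q.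
Proof.
move=> M0 [u [s' [eu lu pu Ps']]] /(_ s' pu Ps') [v [s'' [ev lv pv Qs'']]].
exists (u + v).+1, s''; split=> //; first exact: ExecSeq eu ev.
- by rewrite /= mulSn mulnDl; lia.
- by apply: (preserves_trans (preserves_weak _ _ _ pu) (preserves_weak _ _ _ pv))
    => x /= ->; rewrite ?orbT.
Qed.

(** The body runs in bounded time, so the measure bounds the cost of the loop and
    not only its number of turns.  *)
Lemma runs_while M (I : state R -> Prop) (m : state R -> nat) b c s :
  (0 < M)%N -> loopfree c -> I s -> (m s <= 2 * M)%N ->
  (forall s', preserves c s s' -> I s' -> teval s' b ->
     I (run c s') /\ (m (run c s') < m s')%N) ->
  runs M (While b c) s (fun s' => I s' /\ ~~ teval s' b).
Proof.
move=> M0 lc Is ms step.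
suff total n s1 : (m s1 < n)%N -> I s1 -> preserves c s s1 ->
    exists u s', [/\ exec (While b c) s1 u s',
      (u <= (tcost b + unit_cost c).+1 * (m s1).+1)%N,
      preserves c s s' & I s' /\ ~~ teval s' b].
  have [u [s' [eu lu ps' Q]]] := total _ s (ltnSn _) Is (preserves_refl c s).
  exists u, s'; split=> //; apply: leq_trans lu _.
  have h : ((m s).+1 <= 3 * M)%N by lia.
  by apply: leq_trans (leq_mul (leqnn _) h) _; rewrite /=; nia.
elim: n s1 => // n IHn s1 ms1 Is1 ps1.
case sb: (teval s1 b); last first.
  exists (tcost b).+1, s1; split=> //; last by rewrite sb.
    by apply: ExecWhileFalse; rewrite sb.
  by nia.
have [Ir mr] := step s1 ps1 Is1 sb.
have pr := preserves_trans ps1 (run_preserves c s1).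
have [|u [s' [eu lu pu Q]]] := IHn (run c s1) _ Ir pr; first by lia.
have [v ev lv] := exec_run s1 lc.
exists (tcost b + v + u).+1, s'; split=> //; first exact: ExecWhileTrue ev eu.
by nia.
Qed.

(** The invariant [I i] is taken after the counter [x] has been set to [i].  *)
Lemma runs_for M (I : nat -> state R -> Prop) n x e c s :
  (0 < M)%N -> (n <= 2 * M)%N -> loopfree c -> ~~ sets_ivar c x ->
  I 0 (run (Assign x (Cst 0)) s) ->
  (forall i s', preserves (For x e c) s s' -> I i s' -> ieval s' e = n) ->
  (forall i s', preserves (For x e c) s s' -> (i < n)%N -> ivar s' x = i ->
     I i s' -> I i.+1 (run (Seq c (Assign x (IAdd (Var x) (Cst 1)))) s')) ->
  runs M (For x e c) s (I n).
Proof.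
move=> M0 nM lc cx I0 en step.
apply: (@runs_seq _ _ _ _ (fun s' => s' = run (Assign x (Cst 0)) s)) => //.
  exact: runs_loopfree.
move=> s0 ps0 ->; set s1 := run _ s.
pose J s' := exists2 i, I i s' & (ivar s' x = i /\ (i <= n)%N).
have pw s' :
    preserves (Seq c (Assign x (IAdd (Var x) (Cst 1)))) s1 s' ->
    preserves (For x e c) s s'.
  move=> p; apply: (@preserves_trans _ _ s1).
    by apply: preserves_weak (run_preserves _ _) => y //= ->.
  by apply: preserves_weak p => y //= ->; rewrite ?orbT.
have [||||u [s' [eu lu ps' [[i Ii [ix iln]] /= ni]]]] :=
  @runs_while M J (fun s' => n - ivar s' x)%N (ILt (Var x) e)
    (Seq c (Assign x (IAdd (Var x) (Cst 1)))) s1 M0.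
- by rewrite /= lc.
- by exists 0%N => //; split=> //=; rewrite /upd eqxx.
- by rewrite /= /upd eqxx; lia.
- move=> s' /pw ps' [i Ii [ix iln]]; rewrite /= (en _ _ ps' Ii) ix => lin.
  have cxi : ivar (run c s') x = i by have [-> //] := run_preserves c s'.
  split; last by rewrite /upd eqxx cxi; lia.
  exists i.+1; first exact: step.
  by rewrite /= /upd eqxx cxi addn1.
exists u, s'; split=> //.
suff -> : n = i by [].
by move: ni; rewrite (en i) ?ix; [lia | apply: pw; apply: preserves_weak ps' | ].
Qed.

End Calculus.

(** * The kernel of a matrix with signed components *)

Section SignedComponents.
Variables (R : realType) (k l : nat) (D : 'M[R]_(k, l)).

(** A class of columns is named by its largest member.  Classes are unions of
    connected components, since [root] is constant on rows.  Instead of asking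
    that they be connected, [ker_sign] keeps the consequence of connectedness
    that matters: the name determines a kernel vector on its class. *)
Record signed_components (root : 'I_l -> 'I_l) (x : 'I_l -> R) : Prop :=
  SignedComponents {
    root_row : forall r i j, D r i != 0 -> D r j != 0 -> root i = root j;
    leq_root : forall i : 'I_l, (i <= root i)%N;
    rootK : forall i, root (root i) = root i;
    sign_cases : forall i, x i = 1 \/ x i = -1;
    sign_root : forall i, x (root i) = 1;
    ker_sign : forall y : 'cV_l, D *m y = 0 ->
      forall i, y i 0 = x i * y (root i) 0
  }.

Definition class_vector (root : 'I_l -> 'I_l) (x : 'I_l -> R) m : 'cV[R]_l :=
  \col_i (if root i == m then x i else 0).

Definition balanced root x m : bool :=
  (root m == m) && (D *m class_vector root x m == 0).

(** The matrix [V] of the theorem.  *)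
Definition reduction root x : 'M[R]_l :=
  \matrix_(i, m) (if balanced root x m then class_vector root x m i 0
                  else (i == m)%:R).

Section OneMap.
Variables (root : 'I_l -> 'I_l) (x : 'I_l -> R).
Hypothesis rx : signed_components root x.

Lemma sign_neq0 i : x i != 0.
Proof. by case: (sign_cases rx i) => ->; rewrite ?oppr_eq0 oner_eq0. Qed.

Lemma class_vectorE m i :
  class_vector root x m i 0 = if root i == m then x i else 0.
Proof. by rewrite mxE. Qed.

(** The restriction of a kernel vector to a class stays in the kernel because
    each row lies in one class; on the class it is a multiple of
    [class_vector].  *)
Lemma ker_balanced (y : 'cV_l) i :
  D *m y = 0 -> y i 0 != 0 -> balanced root x (root i).
Proof.
move=> Dy yi; rewrite /balanced (rootK rx) eqxx /=; set m := root i.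
have ym : y m 0 != 0.
  by apply: contraNneq yi => y0; rewrite (ker_sign rx Dy) -/m y0 mulr0.
apply/eqP/colP=> r; rewrite !mxE.
have [/existsP [j /andP [rj /eqP mj]]|] :=
  boolP [exists j, (D r j != 0) && (root j == m)]; last first.
  move=> /existsPn none; rewrite big1 // => j _; rewrite mxE.
  have := none j; rewrite negb_and negbK => /orP [/eqP ->|/negbTE ->].
    by rewrite mul0r.
  by rewrite mulr0.
apply: (mulIf ym); rewrite mul0r big_distrl /=.
have /colP /(_ r) := Dy; rewrite !mxE => {2}<-; apply: eq_bigr => q _.
rewrite mxE; have [-> |rq] := eqVneq (D r q) 0; first by rewrite !mul0r.
by rewrite (ker_sign rx Dy q) (root_row rx rq rj) mj eqxx mulrA.
Qed.

Lemma class_vector_ker m : balanced root x m -> D *m class_vector root x m = 0.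
Proof. by case/andP=> _ /eqP. Qed.

Lemma class_vector_top m : balanced root x m -> class_vector root x m m 0 = 1.
Proof.
case/andP=> /eqP rm _; rewrite class_vectorE rm eqxx.
by have := sign_root rx m; rewrite rm.
Qed.

Lemma mul_reduction i m :
  (D *m reduction root x) i m = if balanced root x m then 0 else D i m.
Proof.
have e : col m (reduction root x) =
    if balanced root x m then class_vector root x m else delta_mx m 0.
  by apply/colP=> j; rewrite !mxE; case: ifP => _; rewrite mxE // eqxx andbT.
have -> : (D *m reduction root x) i m = (D *m col m (reduction root x)) i 0.
  by rewrite [col m _]colE mulmxA -colE [RHS]mxE.
rewrite e; case: ifP => bm; first by rewrite class_vector_ker // mxE.
by rewrite -colE mxE.
Qed.

Lemma reduction_upper : upper_triangular (reduction root x).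
Proof.
move=> i j ji; rewrite mxE; case: ifP => [bj|_].
  rewrite class_vectorE; case: eqP => // rij.
  by have := leq_root rx i; rewrite rij leqNgt ji.
by have -> : (i == j) = false by apply/eqP=> e; rewrite e ltnn in ji.
Qed.

Lemma reduction_entries i j : reduction root x i j \in [:: -1; 0; 1].
Proof.
rewrite mxE class_vectorE; case: ifP => _.
  by case: ifP => _; rewrite ?inE ?eqxx ?orbT //;
     case: (sign_cases rx i) => ->; rewrite eqxx ?orbT.
by case: (i == j); rewrite !inE eqxx ?orbT.
Qed.

Lemma supp_reduction m :
  supp (col m (reduction root x)) =
    if balanced root x m then [set i | root i == m] else [set m].
Proof.
apply/setP=> i; rewrite inE !mxE; case: ifP => _; rewrite !inE.
  by case: ifP => _; rewrite ?sign_neq0 ?eqxx.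
by case: (i == m); rewrite ?oner_eq0 ?eqxx.
Qed.

Hypothesis D0 : forall j, col j D != 0.

(** A row that meets the column [m] of a balanced class also meets another
    column of the class, as otherwise its product with the kernel vector of
    the class would not vanish. *)
Lemma card_supp_reduction m :
  (1 < #|supp (col m (reduction root x))|)%N = balanced root x m.
Proof.
rewrite supp_reduction; case: ifP => bm; last by rewrite cards1.
have [r rm] : exists r, D r m != 0.
  apply/existsP; rewrite -negb_forall; apply: contra (D0 m) => /forallP z.
  by apply/eqP/colP=> r; rewrite !mxE; apply/eqP; rewrite -[_ == _]negbK z.
have rtm : root m = m by case/andP: bm => /eqP.
have [j /andP [jm rj]] : exists j, (j != m) && (D r j != 0).
  apply/existsP; apply: contraNT rm; rewrite negb_exists => /forallP z.
  have /colP /(_ r) := class_vector_ker bm; rewrite !mxE (bigD1 m) //=.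
  rewrite big1 ?addr0 => [|j jm]; last first.
    by have := z j; rewrite jm /= negbK => /eqP ->; rewrite mul0r.
  by rewrite class_vector_top // mulr1 => ->.
apply/card_gt1P; exists j, m; split=> //; rewrite inE ?rtm //.
by rewrite (root_row rx rj rm) rtm.
Qed.

Lemma col_mul_reduction m :
  col m (D *m reduction root x) = if balanced root x m then 0 else col m D.
Proof.
by apply/colP=> i; rewrite mxE mul_reduction; case: ifP; rewrite mxE.
Qed.

Lemma reduction_disjoint (i j : 'I_l) : i != j ->
  (1 < #|supp (col i (reduction root x))|)%N ->
  (1 < #|supp (col j (reduction root x))|)%N ->
  [disjoint supp (col i (reduction root x)) & supp (col j (reduction root x))].
Proof.
rewrite !card_supp_reduction !supp_reduction => ij -> ->.
apply/pred0P=> q /=; rewrite !inE.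
by apply/negbTE; apply: contra ij => /andP [/eqP -> /eqP ->].
Qed.

(** The non-zero columns are the columns of [D] at the indices that are not
    balanced names.  A linear relation between them is a kernel vector [y] that
    vanishes at all balanced names, hence on all balanced classes; by
    [ker_balanced] it vanishes elsewhere, too. *)
Lemma reduction_free : free (nonzero_columns (D *m reduction root x)).
Proof.
set A := D *m _; rewrite /nonzero_columns.
set s := [seq j <- enum 'I_l | col j A != 0].
have us : uniq s by rewrite filter_uniq // enum_uniq.
have sP j : (j \in s) = ~~ balanced root x j.
  rewrite mem_filter mem_enum andbT col_mul_reduction.
  by case: ifP => _; rewrite ?eqxx ?D0.
pose t := in_tuple s.
apply/(@freeP _ _ _ (map_tuple (fun j => col j A) t)) => c c0.
pose y : 'cV[R]_l := \sum_i c i *: delta_mx (tnth t i) 0.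
have yt i : y (tnth t i) 0 = c i.
  rewrite /y summxE (bigD1 i) //= big1 ?addr0 => [|j ji].
    by rewrite !mxE !eqxx mulr1.
  rewrite !mxE (inj_eq (tuple_uniqP t us)) eq_sym (negbTE ji) mulr0.
  by [].
have ys j : balanced root x j -> y j 0 = 0.
  move=> bj; rewrite /y summxE big1 // => i _; rewrite !mxE.
  case: eqP => [jt|_]; last by rewrite mulr0.
  by have := mem_tnth i t; rewrite -jt /t /= sP bj.
have Dy : D *m y = 0.
  rewrite -[RHS]c0 /y mulmx_sumr; apply: eq_bigr => i _.
  rewrite -scalemxAr -colE -tnth_nth tnth_map col_mul_reduction.
  have /negbTE -> // : ~~ balanced root x (tnth t i).
  by rewrite -sP; apply: (mem_tnth i t).
move=> i; rewrite -yt; apply/eqP/negP => /negP yi.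
have := ker_sign rx Dy (tnth t i); rewrite (ys _ (ker_balanced Dy yi)) mulr0.
by move/eqP; rewrite (negbTE yi).
Qed.

End OneMap.

(** The class vector of [m] for one map is a kernel vector that ends at [m].
    For the other map it does not vanish at the name of the class of [m], which
    is at least [m], so that this name is [m].  *)
Lemma balanced_unique root x root' x' m :
  signed_components root x -> signed_components root' x' ->
  balanced root x m -> balanced root' x' m.
Proof.
move=> rx rx' bm; have zk := class_vector_ker bm.
have zm := class_vector_top rx bm.
have /(ker_balanced rx' zk) : class_vector root x m m 0 != 0.
  by rewrite zm oner_eq0.
suff -> : root' m = m by [].
apply/val_inj/anti_leq; rewrite (leq_root rx' m) andbT.
have := ker_sign rx' zk m; rewrite zm class_vectorE.
case: eqP => [e _|_ /eqP]; last by rewrite mulr0 oner_eq0.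
by have := leq_root rx (root' m); rewrite e.
Qed.

(** The class vector of [m] has the entry 1 at [m] and 0 at the other balanced
    names.  A kernel vector is determined by its entries at these names, which
    do not depend on the map.  *)
Lemma reduction_unique root x root' x' :
  signed_components root x -> signed_components root' x' ->
  reduction root x = reduction root' x'.
Proof.
move=> rx rx'; apply/matrixP=> i m; rewrite !mxE.
have bE j : balanced root x j = balanced root' x' j.
  by apply/idP/idP; apply: balanced_unique.
rewrite -bE; case: ifP => // bm; have zk := class_vector_ker bm.
rewrite -!class_vectorE (ker_sign rx' zk i) [RHS]class_vectorE.
have [->|ne] := eqVneq (root' i) m; first by rewrite class_vector_top ?mulr1.
apply/eqP; rewrite mulf_eq0 (negbTE (sign_neq0 rx' i)) /=.
apply: contraNT ne => nz.
have := ker_balanced rx' zk nz; rewrite (rootK rx') -bE => /andP [/eqP rr _].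
move: nz; rewrite class_vectorE rr; by case: (_ == m); rewrite // eqxx.
Qed.

End SignedComponents.
(** * Sparse rows *)

Section SparseRows.
Variables (R : realType) (k l : nat).
Implicit Types (A : 'M[R]_(k, l)) (ptr idx : nat -> nat) (val : nat -> R).

Definition csr_rows A m ptr idx val : Prop :=
  [/\ ptr 0%N = 0%N,
      forall i, (i < m)%N -> (ptr i <= ptr i.+1)%N,
      forall i, (i < m)%N -> uniq [seq idx t | t <- index_iota (ptr i) (ptr i.+1)],
      forall t, (t < ptr m)%N -> (idx t < l)%N /\ val t != 0
    & forall (i : 'I_k) (j : 'I_l), (i < m)%N ->
        A i j = \sum_(ptr i <= t < ptr i.+1 | idx t == j) val t].

(** A storage in which row [m] is being written: [w] is what has been written of
    it, and [n] is the next free cell.  *)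
Definition csr_partial A m w ptr idx val n : Prop :=
  [/\ csr_rows A m ptr idx val, (ptr m <= n)%N
    & [seq (idx t, val t) | t <- index_iota (ptr m) n] = w].

Lemma csr_rows_csr A ptr idx val :
  csr_rows A k ptr idx val <-> is_csr A ptr idx val.
Proof.
by split=> -[p0 pm pu pv pA]; split=> // i j; rewrite pA.
Qed.

Lemma csr_rows_partial A m ptr idx val :
  csr_rows A m ptr idx val -> csr_partial A m [::] ptr idx val (ptr m).
Proof. by move=> h; split=> //; rewrite /index_iota subnn. Qed.

Lemma csr_rows0 A ptr idx val : ptr 0%N = 0%N -> csr_rows A 0 ptr idx val.
Proof. by move=> p0; split=> // t; rewrite p0. Qed.

Lemma csr_ptr_mono A m ptr idx val i j :
  csr_rows A m ptr idx val -> (i <= j <= m)%N -> (ptr i <= ptr j)%N.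
Proof.
case=> _ pm _ _ _ /andP [ij jm]; elim: j ij jm => [|j IHj].
  by rewrite leqn0 => /eqP ->.
rewrite leq_eqVlt => /orP [/eqP -> //|ij] jm.
by apply: leq_trans (IHj _ (ltnW jm)) (pm j jm); rewrite -ltnS.
Qed.

(** The first [m] rows only depend on the cells below [ptr m], which is why
    cells can be appended.  *)
Lemma csr_rows_ext A m ptr idx val ptr' idx' val' :
  (forall i, (i <= m)%N -> ptr' i = ptr i) ->
  (forall t, (t < ptr m)%N -> idx' t = idx t /\ val' t = val t) ->
  csr_rows A m ptr idx val -> csr_rows A m ptr' idx' val'.
Proof.
move=> ep et h; have [p0 pm pu pv pA] := h.
have lt i t : (i < m)%N -> (ptr i <= t < ptr i.+1)%N -> (t < ptr m)%N.
  move=> im /andP [_ ti]; apply: leq_trans ti _.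
  by apply: csr_ptr_mono h _; rewrite im leqnn.
split.
- by rewrite ep.
- by move=> i im; rewrite !ep ?pm // ltnW.
- move=> i im; rewrite !ep ?(ltnW im) //.
  rewrite (_ : map _ _ = [seq idx t | t <- index_iota (ptr i) (ptr i.+1)]) ?pu //.
  by apply/eq_in_map => t; rewrite mem_index_iota => /(lt _ _ im) /et [].
- by move=> t; rewrite ep // => tm; have [-> ->] := et t tm; apply: pv.
- move=> i j im; rewrite pA // !ep ?(ltnW im) //.
  apply: congr_big_nat => // t; first by move=> /(lt _ _ im) /et [->].
  by case/and3P=> _ a b; have [] := et t (lt _ _ im (introT andP (conj a b))).
Qed.

Lemma csr_emit A m w ptr idx val n j e :
  csr_partial A m w ptr idx val n ->
  csr_partial A m (rcons w (j, e)) ptr (upd idx n j) (upd val n e) n.+1.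
Proof.
case=> h mn ew; split; last 1 first.
- rewrite /index_iota subSn // -addn1 iotaD map_cat -cats1 -ew /=.
  congr (_ ++ _); last by rewrite subnKC // /upd eqxx.
  apply/eq_in_map => t; rewrite mem_index_iota => /andP [_ tn].
  by rewrite /upd ltn_eqF.
- apply: csr_rows_ext h => // t tm; rewrite /upd ltn_eqF //.
  exact: leq_trans tm mn.
- exact: leqW.
Qed.

Lemma csr_close A m w ptr idx val n :
  csr_partial A m w ptr idx val n ->
  uniq [seq c.1 | c <- w] ->
  (forall c, c \in w -> (c.1 < l)%N /\ c.2 != 0) ->
  (forall (i : 'I_k) (j : 'I_l), i = m :> nat ->
     A i j = \sum_(c <- w | c.1 == j) c.2) ->
  csr_rows A m.+1 (upd ptr m.+1 n) idx val.
Proof.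
move=> [h mn ew] uw bw sw; set ptr' := upd _ _ _.
have e1 : ptr' m.+1 = n by rewrite /ptr' /upd eqxx.
have e2 i : (i <= m)%N -> ptr' i = ptr i.
  by move=> im; rewrite /ptr' /upd ltn_eqF.
have [p0 pm pu pv pA] : csr_rows A m ptr' idx val by apply: csr_rows_ext h.
rewrite e2 // in pv.
split=> //.
- move=> i; rewrite ltnS leq_eqVlt => /orP [/eqP ->|]; last exact: pm.
  by rewrite e1 e2.
- move=> i; rewrite ltnS leq_eqVlt => /orP [/eqP ->|]; last exact: pu.
  by rewrite e1 e2 //; move: uw; rewrite -ew -map_comp.
- move=> t; rewrite e1 => tn; have [tm|mt] := ltnP t (ptr m); first exact: pv.
  apply: (bw (idx t, val t)); rewrite -ew.
  by apply/mapP; exists t => //; rewrite mem_index_iota mt.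
- move=> i j; rewrite ltnS leq_eqVlt => /orP [/eqP im|]; last exact: pA.
  by rewrite sw // -ew big_map im e1 e2.
Qed.

(** A storage of [D] provides a run of the program, from which the reduction is
    taken that all other runs have to reproduce.  *)
Lemma csr_exists A : exists ptr idx val, is_csr A ptr idx val.
Proof.
suff ex m : (m <= k)%N -> exists ptr idx val, csr_rows A m ptr idx val.
  have [ptr [idx [val h]]] := ex k (leqnn k).
  by exists ptr, idx, val; apply/csr_rows_csr.
elim: m => [|m IHm] mk.
  by exists (fun=> 0%N), (fun=> 0%N), (fun=> 0); apply: csr_rows0.
have [ptr [idx [val h]]] := IHm (ltnW mk); pose i := Ordinal mk.
pose w := [seq (nat_of_ord j, A i j) | j <- enum 'I_l & A i j != 0].
have [idx' [val' [n h']]] : exists idx' val' n, csr_partial A m w ptr idx' val' n.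
  elim/last_ind: w => [|w [j e] [idx' [val' [n hw]]]].
    by exists idx, val, (ptr m); apply: csr_rows_partial.
  by exists (upd idx' n j), (upd val' n e), n.+1; apply: csr_emit.
exists (upd ptr m.+1 n), idx', val'; apply: csr_close h' _ _ _.
- rewrite -map_comp map_inj_uniq; last exact: ord_inj.
  by rewrite filter_uniq // enum_uniq.
- by move=> c /mapP [j]; rewrite mem_filter => /andP [nz _] ->; split=> /=.
- move=> i' j im; have -> : i' = i by apply: ord_inj.
  rewrite big_map big_filter_cond big_enum_cond /=.
  have [z|nz] := eqVneq (A i j) 0.
    rewrite z big_pred0 // => q; have [e|] := eqVneq (q : nat) j; last by rewrite andbF.
    by rewrite (ord_inj e) z eqxx.
  rewrite (big_pred1 j) // => q /=.
  have [->|/negbTE ne] := eqVneq q j; first by rewrite nz eqxx.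
  by rewrite -val_eqE /= in ne; rewrite ne andbF.
Qed.

End SparseRows.

(** * Cells of a non-branching matrix *)

(** The mate of a cell is the other cell of its row, or the cell itself if it is
    alone.  In both cases the row equation says that this sum vanishes; a single
    cell is counted twice, which is harmless in characteristic 0.  *)
Definition cell_eq (R : realType) (idx mate : nat -> nat) (val y : nat -> R) t : R :=
  val t * y (idx t) + val (mate t) * y (idx (mate t)).

Section Cells.
Variables (R : realType) (k l : nat) (D : 'M[R]_(k, l)).
Variables (ptr idx : nat -> nat) (val : nat -> R).
Hypotheses (nbD : non_branching D) (csrD : is_csr D ptr idx val).

Lemma row_of m t : (m <= k)%N -> (t < ptr m)%N ->
  exists2 i, (i < m)%N & (ptr i <= t < ptr i.+1)%N.
Proof.
have [p0 _ _ _ _] := csrD; elim: m => [|m IHm] mk; first by rewrite p0.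
move=> tm; have [|mt] := ltnP t (ptr m); last by exists m => //; rewrite mt.
by case/(IHm (ltnW mk)) => i im ti; exists i => //; apply: ltnW.
Qed.

Lemma ptr_le i : (i <= k)%N -> (ptr i <= ptr k)%N.
Proof.
by move=> ik; apply: (csr_ptr_mono ((csr_rows_csr _ _ _ _).2 csrD)); rewrite ik /=.
Qed.

Lemma idx_inj i t t' : (i < k)%N ->
  (ptr i <= t < ptr i.+1)%N -> (ptr i <= t' < ptr i.+1)%N ->
  idx t = idx t' -> t = t'.
Proof.
move=> ik ti ti' e; have [_ _ pu _ _] := csrD.
have /(uniqP 0%N) u := pu i ik.
have sz q : (ptr i <= q < ptr i.+1)%N ->
    (q - ptr i < size [seq idx t | t <- index_iota (ptr i) (ptr i.+1)])%N.
  by rewrite size_map size_iota; lia.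
have nq q : (ptr i <= q < ptr i.+1)%N ->
    nth 0%N [seq idx t | t <- index_iota (ptr i) (ptr i.+1)] (q - ptr i) = idx q.
  by move=> qi; rewrite (nth_map 0%N) ?size_iota ?nth_iota ?subnKC; lia.
have := u _ _ (sz _ ti) (sz _ ti'); rewrite !nq // => /(_ e); lia.
Qed.

Lemma cell_bound t : (t < ptr k)%N -> (idx t < l)%N.
Proof. by have [_ _ _ pv _] := csrD; move=> /pv []. Qed.

Lemma cell_entry (i : 'I_k) (j : 'I_l) t :
  (ptr i <= t < ptr i.+1)%N -> idx t = j -> D i j = val t.
Proof.
move=> ti tj; have [_ _ _ _ ->] := csrD.
rewrite big_mkcond (bigD1_seq t) /= ?mem_index_iota ?iota_uniq // tj eqxx.
rewrite big1_seq ?addr0 // => q /andP [qt]; rewrite mem_index_iota => qi.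
case: eqP => // qj; case/eqP: qt.
by apply: (idx_inj (ltn_ord i)); rewrite ?qj.
Qed.

Lemma entry_cell (i : 'I_k) (j : 'I_l) : D i j != 0 ->
  exists2 t, (ptr i <= t < ptr i.+1)%N & idx t = j.
Proof.
have [_ _ _ _ ->] := csrD => nz.
have [/hasP [t ti /eqP tj]|/hasPn none] :=
  boolP (has (fun t => idx t == j) (index_iota (ptr i) (ptr i.+1))).
  by exists t => //; rewrite -mem_index_iota.
move: nz; rewrite big_nat_cond big_pred0 ?eqxx // => t.
by apply/negbTE; apply/negP=> /andP [ti]; apply/negP/none; rewrite mem_index_iota.
Qed.

Lemma row_size i : (i < k)%N -> (ptr i.+1 - ptr i <= 2)%N.
Proof.
move=> ik; have [_ _ pu pv _] := csrD.
apply: leq_trans (nbD.2 (Ordinal ik)).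
rewrite cardE -(size_map (@nat_of_ord l)).
rewrite -[X in (X <= _)%N](size_iota (ptr i)) -(size_map idx).
apply: uniq_leq_size (pu i ik) _ => j /mapP [t].
rewrite mem_index_iota => ti ->.
have tk : (t < ptr k)%N.
  by case/andP: ti => _ ti; apply: leq_trans ti (ptr_le ik).
have [tl nz] := pv t tk; apply/mapP; exists (Ordinal tl) => //.
by rewrite mem_enum inE (@cell_entry (Ordinal ik) (Ordinal tl) t).
Qed.

Lemma cells_le : (ptr k <= 2 * k)%N.
Proof.
have [p0 _ _ _ _] := csrD.
suff h m : (m <= k)%N -> (ptr m <= 2 * m)%N by apply: h.
elim: m => [|m IHm] mk; first by rewrite p0.
by have := row_size mk; have := IHm (ltnW mk); lia.
Qed.

Lemma val_sign t : (t < ptr k)%N -> val t = 1 \/ val t = -1.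
Proof.
move=> tk; have [i ik ti] := row_of (leqnn k) tk.
have [_ _ _ pv _] := csrD; have [tl nz] := pv t tk.
have := nbD.1 (Ordinal ik) (Ordinal tl).
rewrite (@cell_entry (Ordinal ik) (Ordinal tl) t) // !inE (negbTE nz).
by case/orP=> [/eqP ->|/eqP ->]; [right|left].
Qed.

Lemma row_sum (i : 'I_k) (y : nat -> R) :
  \sum_j D i j * y j = \sum_(ptr i <= t < ptr i.+1) val t * y (idx t).
Proof.
have [_ _ _ pv pA] := csrD.
under eq_bigr => j _ do rewrite pA big_mkcond /= big_distrl /=.
rewrite exchange_big /= big_nat_cond [RHS]big_nat_cond.
apply: eq_bigr => t; rewrite andbT => /andP [_ ti].
have [tl _] := pv t (leq_trans ti (ptr_le (ltn_ord i))).
rewrite (bigD1 (Ordinal tl)) //= eqxx big1 ?addr0 // => j.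
by rewrite -val_eqE /= eq_sym => /negbTE ->; rewrite mul0r.
Qed.

Variable mate : nat -> nat.
(* Mates are mirror images in their row.  As a row has at most two cells, this is
   the other cell of the row, if any.  *)
Hypothesis mateP : forall i t, (i < k)%N -> (ptr i <= t < ptr i.+1)%N ->
  (mate t + t).+1 = (ptr i + ptr i.+1)%N.

Lemma mate_row i t : (i < k)%N ->
  (ptr i <= t < ptr i.+1)%N -> (ptr i <= mate t < ptr i.+1)%N.
Proof. by move=> ik ti; have := mateP ik ti; lia. Qed.

Lemma mate_bound t : (t < ptr k)%N -> (mate t < ptr k)%N.
Proof.
move=> tk; have [i ik ti] := row_of (leqnn k) tk.
by have /andP [_ h] := mate_row ik ti; apply: leq_trans h (ptr_le ik).
Qed.

Lemma mateK t : (t < ptr k)%N -> mate (mate t) = t.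
Proof.
move=> tk; have [i ik ti] := row_of (leqnn k) tk.
have := mateP ik ti; have := mateP ik (mate_row ik ti); lia.
Qed.

Lemma row_cases i t t' : (i < k)%N ->
  (ptr i <= t < ptr i.+1)%N -> (ptr i <= t' < ptr i.+1)%N ->
  t' = t \/ t' = mate t.
Proof.
by move=> ik ti ti'; have := row_size ik; have := mateP ik ti; lia.
Qed.

Lemma cells_kernel (y : nat -> R) :
  D *m \col_j y j = 0 <->
  (forall t, (t < ptr k)%N -> cell_eq idx mate val y t = 0).
Proof.
have rowE (i : 'I_k) : (D *m \col_j y j) i 0 =
    \sum_(ptr i <= t < ptr i.+1) val t * y (idx t).
  by rewrite -row_sum mxE; apply: eq_bigr => j _; rewrite mxE.
rewrite /cell_eq; split=> [Dy t tk|E].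
  have [i ik ti] := row_of (leqnn k) tk.
  have := mateP ik ti; have := row_size ik; have := rowE (Ordinal ik).
  rewrite Dy mxE /=; have [e sum _ m|ne sum sz m] := eqVneq (ptr i.+1) (ptr i).+1.
    have [-> ->] : mate t = ptr i /\ t = ptr i by lia.
    by move: sum; rewrite e big_nat1 => <-; rewrite addr0.
  have e : ptr i.+1 = (ptr i).+2 by lia.
  move: sum; rewrite e big_ltn // big_nat1.
  have [->|->] : t = ptr i \/ t = (ptr i).+1 by lia.
    by have -> : mate (ptr i) = (ptr i).+1 by move: mateP => /(_ i (ptr i)); lia.
  have -> : mate (ptr i).+1 = ptr i by move: mateP => /(_ i (ptr i).+1); lia.
  by rewrite addrC.
apply/colP=> i; rewrite rowE mxE; have ik := ltn_ord i.
have [_ /(_ i ik) pi _ _ _] := csrD.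
have sz := row_size ik.
have [e|[e|e]] : ptr i.+1 = ptr i \/ ptr i.+1 = (ptr i).+1 \/
  ptr i.+1 = (ptr i).+2 by lia.
- by rewrite e big_geq.
- have ti : (ptr i <= ptr i < ptr i.+1)%N by lia.
  have m : mate (ptr i) = ptr i by have := mateP ik ti; lia.
  have := E (ptr i); rewrite m e big_nat1 => /(_ _) h.
  have /eqP := h (leq_trans (andP ti).2 (ptr_le ik)).
  by rewrite -mulr2n mulrn_eq0 /= => /eqP.
- have ti : (ptr i <= ptr i < ptr i.+1)%N by lia.
  have m : mate (ptr i) = (ptr i).+1 by have := mateP ik ti; lia.
  have := E (ptr i) (leq_trans (andP ti).2 (ptr_le ik)).
  by rewrite m e big_ltn // big_nat1.
Qed.

End Cells.

(** * The search *)

(** The link to the last cell before [b] that lies in the column [j].  Links are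
    cell numbers plus one, and 0 is the end of a list.  *)
Definition last_cell (idx : nat -> nat) j b c : Prop :=
  [/\ (c <= b)%N, (0 < c)%N -> idx c.-1 = j
    & forall t, (t < b)%N -> idx t = j -> (t < c)%N].

Lemma count_lt (T : eqType) (a b : pred T) (s : seq T) z :
  z \in s -> a z -> ~~ b z -> (forall t, t \in s -> b t -> a t) ->
  (count b s < count a s)%N.
Proof.
have weak (r : seq T) : (forall t, t \in r -> b t -> a t) ->
    (count b r <= count a r)%N.
  elim: r => //= t r IHr sub; rewrite leq_add //.
    by case bt: (b t) => //; rewrite sub ?inE ?eqxx.
  by apply: IHr => q qr; apply: sub; rewrite inE qr orbT.
elim: s => //= t s IHs; rewrite inE => /orP [/eqP <- az /negbTE bz sub|zs az bz sub].
  by rewrite az bz ltnS weak // => q qs; apply: sub; rewrite inE qs orbT.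
rewrite -addnS leq_add //.
  by case bt: (b t) => //; rewrite sub ?inE ?eqxx.
by apply: IHs => // q qs; apply: sub; rewrite inE qs orbT.
Qed.

Section Search.
Variables (R : realType) (l N : nat) (idx mate head next : nat -> nat).
Variable val : nat -> R.
Hypotheses (idx_l : forall t, (t < N)%N -> (idx t < l)%N)
  (mate_N : forall t, (t < N)%N -> (mate t < N)%N)
  (mate_mate : forall t, (t < N)%N -> mate (mate t) = t)
  (val_pm : forall t, (t < N)%N -> val t = 1 \/ val t = -1)
  (headP : forall j, last_cell idx j N (head j))
  (nextP : forall t, (t < N)%N -> last_cell idx (idx t) t (next t)).

(** Membership in the kernel of [D], in terms of cells.  *)
Definition kernel (y : nat -> R) : Prop :=
  forall t, (t < N)%N -> cell_eq idx mate val y t = 0.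

(** [root w] is 0 for a column [w] that was not reached, and otherwise one more
    than the name of its class.  *)
Definition labelled (root : nat -> nat) (x : nat -> R) w : Prop :=
  [/\ (w < root w <= l)%N, root (root w).-1 = root w, x w = 1 \/ x w = -1,
      x (root w).-1 = 1
    & forall y, kernel y -> y w = x w * y (root w).-1].

(** The cells of a column taken from the queue, except those from [cur] down in
    the list under exploration, have been compared with their mates.  *)
Definition explored (Q : nat -> nat) h cur t : bool :=
  (idx t \in mkseq Q h) && ~~ ((t < cur)%N && (idx t == idx cur.-1)).

(** The variable [v] is the name of the class under construction, [Q] is a queue
    with [n] entries of which [h] have been taken out, and [cur] is the link to
    the next cell to be compared with its mate.  *)
Record search_inv (v h n cur : nat) (root Q : nat -> nat) (x : nat -> R) : Prop :=
  SearchInv {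
    si_hn : (h <= n)%N;
    si_uniq : uniq (mkseq Q n);
    si_queue : forall w, (w \in mkseq Q n) = (root w != 0%N);
    si_label : forall w, root w != 0%N -> labelled root x w;
    si_mate : forall t, (t < N)%N -> explored Q h cur t ->
      root (idx (mate t)) = root (idx t);
    (* Every class other than the one under construction is finished.  *)
    si_open : forall t, (t < N)%N -> root (idx t) != 0%N ->
      explored Q h cur t \/ root (idx t) = v.+1;
    si_cur : (cur <= N)%N;
    si_curq : (0 < cur)%N -> idx cur.-1 \in mkseq Q h
  }.

(** Each step of the search decreases one of the summands and increases none.  It
    starts with at most [2 * l + N].  *)
Definition potential v (h cur : nat) (Q : nat -> nat) : nat :=
  v + (l - h) + count (predC (explored Q h cur)) (iota 0 N).

Lemma mkseq_upd (Q : nat -> nat) h n w : (h <= n)%N ->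
  mkseq (upd Q n w) h = mkseq Q h.
Proof.
move=> hn; apply/eq_in_map => i; rewrite mem_iota /= add0n => ih.
by rewrite /upd ltn_eqF // (leq_trans ih).
Qed.

Lemma explored_upd (Q : nat -> nat) h n cur w : (h <= n)%N ->
  explored (upd Q n w) h cur =1 explored Q h cur.
Proof. by move=> hn t; rewrite /explored mkseq_upd. Qed.

Lemma search_init Q x : search_inv l 0 0 0 (fun=> 0%N) Q x.
Proof. by split. Qed.

Lemma potential_upd v (Q : nat -> nat) h n cur w : (h <= n)%N ->
  potential v h cur (upd Q n w) = potential v h cur Q.
Proof.
move=> hn; congr (_ + _)%N; apply: eq_count => t /=.
by rewrite explored_upd.
Qed.

Lemma queue_size v h n cur root Q x :
  search_inv v h n cur root Q x -> (n <= l)%N.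
Proof.
move=> inv; rewrite -(size_mkseq Q n) -(size_iota 0 l).
apply: uniq_leq_size (si_uniq inv) _ => w; rewrite (si_queue inv) mem_iota.
by move=> /(si_label inv) [wl _ _ _ _]; lia.
Qed.

Lemma queue_reached v h n cur root Q x w :
  search_inv v h n cur root Q x -> w \in mkseq Q h -> root w != 0%N.
Proof.
move=> inv; rewrite -(si_queue inv) => /mapP [i]; rewrite mem_iota => ih ->.
by apply: map_f; rewrite mem_iota; have := si_hn inv; lia.
Qed.

(** Reaching a column [w]: either [w] opens the class [v], or it takes over the
    sign that its kernel equation dictates.  *)
Lemma search_visit v h n cur root Q x w e :
  search_inv v h n cur root Q x -> root w = 0%N -> (w <= v < l)%N ->
  e = 1 \/ e = -1 ->
  (w = v /\ e = 1) \/
  (root v = v.+1 /\ forall y, kernel y -> y w = e * y v) ->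
  search_inv v h n.+1 cur (upd root w v.+1) (upd Q n w) (upd x w e).
Proof.
move=> inv rw /andP [wv vl] e1 ev.
have old q : root q != 0%N -> (q == w) = false.
  by move=> rq; apply/negbTE; apply: contra_neqN rq => /eqP ->.
have rootE q : (upd root w v.+1 q != 0%N) = (q == w) || (root q != 0%N).
  by rewrite /upd; case: (q == w).
have exE := explored_upd Q cur w (si_hn inv).
split.
- exact: leqW (si_hn inv).
- rewrite mkseqS mkseq_upd // rcons_uniq (si_uniq inv) andbT.
  by rewrite (si_queue inv) {1}/upd eqxx rw.
- move=> q; rewrite mkseqS mkseq_upd // {1}/upd eqxx mem_rcons inE rootE.
  by rewrite (si_queue inv).
- move=> q; rewrite rootE => /orP [/eqP ->|rq].
    rewrite /labelled /upd eqxx /=.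
    case: ev => [[-> ->]|[rv ev]].
      by rewrite eqxx; split=> //; [lia | left | move=> y _; rewrite mul1r].
    have vw := old v; rewrite rv /= in vw; rewrite vw //.
    have [_ _ _ xv _] : labelled root x v by apply: (si_label inv); rewrite rv.
    by rewrite rv /= in xv; split=> //; lia.
  have [lt rr xs xr yk] := si_label inv rq.
  by rewrite /labelled /upd (old q rq) (old (root q).-1) ?rr.
- move=> t tN; rewrite exE => et; have er := si_mate inv tN et.
  have rt : root (idx t) != 0%N.
    by case/andP: et => /(queue_reached inv).
  by rewrite /upd !old ?er.
- move=> t tN; rewrite rootE exE /upd; case: eqP => [->|/eqP _] /=.
    by right.
  exact: (si_open inv).
- exact: (si_cur inv).
- by rewrite mkseq_upd ?(si_hn inv) //; apply: (si_curq inv).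
Qed.

Section Step.
Variables (v h n cur : nat) (root Q : nat -> nat) (x : nat -> R).
Hypothesis inv : search_inv v h n cur root Q x.

(** The current cell is open, so its column belongs to the current class.  *)
Lemma current_root : (0 < cur)%N -> root (idx cur.-1) = v.+1.
Proof.
move=> c0; have cN := si_cur inv.
have nz := queue_reached inv (si_curq inv c0).
have [||] := si_open inv (t := cur.-1) _ nz; [lia| |by []].
by rewrite /explored eqxx andbT => /andP [_ /negP []]; lia.
Qed.

Lemma explored_next t : (0 < cur)%N -> (t < N)%N ->
  explored Q h (next cur.-1) t = explored Q h cur t || (t == cur.-1).
Proof.
move=> c0 tN; have cN := si_cur inv; have cq := si_curq inv c0.
have [nle nidx nmax] := nextP (t := cur.-1) (ltac:(lia)).
rewrite /explored; have [->|tc] := eqVneq t cur.-1.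
  by rewrite orbT cq /= ltnNge nle.
rewrite orbF; case tq: (idx t \in mkseq Q h) => //=; congr (~~ _).
apply/andP/andP=> -[lt /eqP e].
  by split; [lia | rewrite e nidx //; lia].
have lt' : (t < next cur.-1)%N by apply: nmax => //; lia.
by split=> //; rewrite nidx ?e //; lia.
Qed.

(** The mate of the current cell lies in a reached column.  If that column
    belonged to a finished class, the mate would have been explored and the
    current column would belong to the same class.  *)
Lemma search_next : (0 < cur)%N -> root (idx (mate cur.-1)) != 0%N ->
  search_inv v h n (next cur.-1) root Q x /\
  (potential v h (next cur.-1) Q < potential v h cur Q)%N.
Proof.
move=> c0 rm; have cN := si_cur inv; have cr := current_root c0.
have tN : (cur.-1 < N)%N by lia.
have [nle nidx _] := nextP tN.
have exn t : (t < N)%N -> explored Q h (next cur.-1) t =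
  explored Q h cur t || (t == cur.-1) by apply: explored_next.
split.
  split; rewrite ?(si_hn inv) ?(si_uniq inv) //.
  - exact: (si_queue inv).
  - exact: (si_label inv).
  - move=> t tN'; rewrite exn // => /orP [|/eqP ->]; first exact: (si_mate inv).
    have [/(si_mate inv (mate_N tN)) <-|->] := si_open inv (mate_N tN) rm.
      by rewrite mate_mate.
    by rewrite cr.
  - move=> t tN' rt; rewrite exn //.
    by have [->|->] := si_open inv tN' rt; [left|right].
  - lia.
  - by move/nidx => ->; apply: (si_curq inv).
rewrite /potential ltn_add2l; apply: (@count_lt _ _ _ _ cur.-1).
- by rewrite mem_iota.
- by rewrite /= /explored (si_curq inv c0) eqxx andbT negbK; lia.
- by rewrite /= exn // eqxx orbT.
- by move=> t; rewrite mem_iota => /= tN'; rewrite exn // negb_or => /andP [].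
Qed.

(** Taking a column out of the queue leaves all of its cells to be compared.  *)
Lemma explored_pop t : cur = 0%N -> (h < n)%N -> (t < N)%N ->
  explored Q h.+1 (head (Q h)) t = explored Q h 0 t.
Proof.
move=> c0 hn tN; have [_ hidx hmax] := headP (Q h).
have nQ : Q h \notin mkseq Q h.
  have : uniq (mkseq Q h.+1).
    apply: subseq_uniq (si_uniq inv); apply: map_subseq.
    by rewrite -(subnKC hn) iotaD prefix_subseq.
  by rewrite mkseqS rcons_uniq => /andP [].
rewrite /explored mkseqS mem_rcons inE /= andbT.
have [e|ne] /= := eqVneq (idx t) (Q h).
  have lt := hmax t tN e; rewrite e lt hidx ?eqxx ?(negbTE nQ) //.
  exact: leq_ltn_trans lt.
case: (idx t \in _) => //=; apply/negP=> /andP [lt /eqP e].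
by move/eqP: ne; apply; rewrite e hidx //; apply: leq_ltn_trans lt.
Qed.

Lemma search_pop : cur = 0%N -> (h < n)%N ->
  search_inv v h.+1 n (head (Q h)) root Q x /\
  (potential v h.+1 (head (Q h)) Q < potential v h cur Q)%N.
Proof.
move=> c0 hn; have [hle hidx _] := headP (Q h).
have nl := queue_size inv.
have exn t : (t < N)%N -> explored Q h.+1 (head (Q h)) t = explored Q h cur t.
  by move=> tN; rewrite explored_pop // c0.
split.
  split; rewrite ?(si_uniq inv) //.
  - exact: (si_queue inv).
  - exact: (si_label inv).
  - by move=> t tN; rewrite exn //; apply: (si_mate inv).
  - by move=> t tN; rewrite exn //; apply: (si_open inv).
  - by move/hidx => ->; rewrite mkseqS mem_rcons inE eqxx.
rewrite /potential (@eq_in_count _ _ (predC (explored Q h cur))) => [|t].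
  by rewrite ltn_add2r ltn_add2l; lia.
by rewrite mem_iota => /= tN; rewrite exn.
Qed.

(** With nothing left to explore, all reached cells are explored and the next
    class name can be tried. *)
Lemma search_close u : cur = 0%N -> h = n -> search_inv u h n cur root Q x.
Proof.
move=> c0 hn; split; rewrite ?(si_hn inv) ?(si_uniq inv) ?(si_cur inv) //.
- exact: (si_queue inv).
- exact: (si_label inv).
- exact: (si_mate inv).
- by move=> t tN rt; left; rewrite /explored c0 hn (si_queue inv) rt.
- exact: (si_curq inv).
Qed.

(** When the queue is empty and no cell is left in the current list, the cells of
    all reached columns are explored. *)
Lemma search_done : cur = 0%N -> h = n ->
  (forall w, (w < l)%N -> root w != 0%N) ->
  (forall w, (w < l)%N -> labelled root x w) /\
  (forall t, (t < N)%N -> root (idx (mate t)) = root (idx t)).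
Proof.
move=> c0 hn all_reached; split=> [w wl|t tN].
  exact/(si_label inv)/all_reached.
apply: (si_mate inv) => //; rewrite /explored c0 hn (si_queue inv) andbT.
exact/all_reached/idx_l.
Qed.

End Step.
End Search.
(** * The program *)

(** Outside the input, the memory is zero at the start.  In arrays, 0 stands for the
    end of a list, for a column that was not reached, and for a class without
    violated row equation.  *)
Local Notation i_ := (Var 2).
Local Notation class_ := (Var 3).
Local Notation taken_ := (Var 4).
Local Notation queued_ := (Var 5).
Local Notation cell_ := (Var 6).
Local Notation new_ := (Var 7).
Local Notation out_ := (Var 8).
Local Notation "e .+i" := (IAdd e (Cst 1)) (at level 2, format "e .+i").
Local Notation "e .-i" := (ISub e (Cst 1)) (at level 2, format "e .-i").
Local Notation ptr_ := (IGet 0).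
Local Notation idx_ := (IGet 1).
Local Notation mate_ := (IGet 6).
Local Notation head_ := (IGet 7).
Local Notation next_ := (IGet 8).
Local Notation root_ := (IGet 9).
Local Notation queue_ := (IGet 10).
Local Notation bad_ := (IGet 11).
Local Notation val_ := (RGet 0).
Local Notation sign_ := (RGet 3).

Definition link_mates : prog :=
  For 2 (Var 0)
    (If (ILt (ptr_ i_) (ptr_ i_.+i))
        (Seq (ISet 6 (ptr_ i_) (ptr_ i_.+i).-i)
             (ISet 6 (ptr_ i_.+i).-i (ptr_ i_)))
        Skip).

(** The cells of a column form a list from the last to the first.  *)
Definition link_columns : prog :=
  For 2 (ptr_ (Var 0))
    (Seq (ISet 8 i_ (head_ (idx_ i_))) (ISet 7 (idx_ i_) i_.+i)).

Definition visit (e : rexp) : prog :=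
  If (IEq (root_ new_) (Cst 0))
     (Seq (RSet 3 new_ e)
     (Seq (ISet 10 queued_ new_)
     (Seq (ISet 9 new_ class_.+i)
          (Assign 5 queued_.+i))))
     Skip.

(** Compare the current cell with its mate and give the column of the mate, if
    it is new, the sign that solves the row equation; otherwise take the next
    column from the queue; otherwise try the next starting point.  *)
Definition search_step : prog :=
  If (ILt (Cst 0) cell_)
     (Seq (Assign 7 (idx_ (mate_ cell_.-i)))
     (Seq (visit (RSub (RSub One One)
                       (RMul (RMul (val_ cell_.-i) (val_ (mate_ cell_.-i)))
                             (sign_ (idx_ cell_.-i)))))
          (Assign 6 (next_ cell_.-i))))
  (If (ILt taken_ queued_)
     (Seq (Assign 6 (head_ (queue_ taken_))) (Assign 4 taken_.+i))
     (Seq (Assign 3 class_.-i) (Seq (Assign 7 class_) (visit One)))).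

Definition search : prog :=
  Seq (Assign 3 (Var 1))
      (While (ILt (Cst 0) (IAdd (IAdd class_ (ISub queued_ taken_)) cell_))
             search_step).

(** Signs are not compared during the search; one pass afterwards finds the
    classes with a violated row equation.  *)
Definition mark_bad : prog :=
  For 2 (ptr_ (Var 0))
    (If (REq (RAdd (RMul (val_ i_) (sign_ (idx_ i_)))
                   (RMul (val_ (mate_ i_)) (sign_ (idx_ (mate_ i_)))))
             (RSub One One))
        Skip
        (ISet 11 (root_ (idx_ i_)) (Cst 1))).

Definition emit (a b : nat) (e : iexp) (f : rexp) : prog :=
  Seq (ISet a out_ e) (Seq (RSet b out_ f) (Assign 8 out_.+i)).

(** The cell is skipped if it does not belong to the row, or if its column is the
    name of a balanced class and thus becomes zero.  *)
Definition copy_cell (d : nat) : prog :=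
  let t := IAdd (ptr_ i_) (Cst d) in
  If (And (ILt t (ptr_ i_.+i))
          (Not (And (IEq (root_ (idx_ t)) (idx_ t).+i)
                    (IEq (bad_ (idx_ t).+i) (Cst 0)))))
     (emit 3 1 (idx_ t) (val_ t)) Skip.

Definition write_product : prog :=
  Seq (Assign 8 (Cst 0))
      (For 2 (Var 0)
        (Seq (Seq (copy_cell 0) (copy_cell 1)) (ISet 2 i_.+i out_))).

(** Row [i] has the entry 1 on the diagonal, also if [i] is a balanced name, and
    the sign of [i] in the column of the name of its class, if this is another
    column and the class is balanced.  *)
Definition write_reduction : prog :=
  Seq (Assign 8 (Cst 0))
      (For 2 (Var 1)
        (Seq (Seq (emit 5 2 i_ One)
                  (If (And (Not (IEq (root_ i_) i_.+i))
                           (IEq (bad_ (root_ i_)) (Cst 0)))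
                      (emit 5 2 (root_ i_).-i (sign_ i_)) Skip))
             (ISet 4 i_.+i out_))).

Definition reduce : prog :=
  Seq link_mates (Seq link_columns (Seq search
    (Seq mark_bad (Seq write_product write_reduction)))).

(** * Correctness of the program *)

Section Phases.
Variables (R : realType) (k l : nat) (D : 'M[R]_(k, l)).
Variables (ptr idx : nat -> nat) (val : nat -> R).
Hypotheses (nbD : non_branching D) (csrD : is_csr D ptr idx val).
Let M := (k + l + 1)%N.

Lemma M_gt0 : (0 < M)%N. Proof. by rewrite /M addn1. Qed.

Lemma cells_M : (ptr k <= 2 * M)%N.
Proof. by have := cells_le nbD csrD; rewrite /M; lia. Qed.

Definition has_input (s : state R) : Prop :=
  [/\ ivar s 0 = k, ivar s 1 = l, iarr s 0 =1 ptr, iarr s 1 =1 idx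
    & rarr s 0 =1 val].

Lemma has_input_preserved c s s' : preserves c s s' ->
  ~~ [|| sets_ivar c 0, sets_ivar c 1, sets_iarr c 0, sets_iarr c 1
       | sets_rarr c 0] ->
  has_input s -> has_input s'.
Proof.
case=> pv pi pr; rewrite !negb_or => /and5P [v0 v1 i0 i1 r0] [].
by split=> *; rewrite ?pv ?pi ?pr.
Qed.

Definition mate_spec (mate : nat -> nat) m : Prop :=
  forall i t, (i < m)%N -> (ptr i <= t < ptr i.+1)%N ->
    (mate t + t).+1 = (ptr i + ptr i.+1)%N.

Lemma run_link_mates s : has_input s ->
  runs M link_mates s (fun s' => mate_spec (iarr s' 6) k).
Proof.
move=> hs; apply: (runs_for (n := k) (x := 2) (I := fun i s' => mate_spec (iarr s' 6) i))
  => //; rewrite ?M_gt0 ?/M //; first lia.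
  by move=> i s' /has_input_preserved /(_ isT hs) [].
move=> i [iv ia ra] /has_input_preserved /(_ isT hs) [/= _ _ ep _ _] ik vi Ii.
have [_ pm _ _ _] := csrD; have sz := row_size nbD csrD ik.
move=> q t; rewrite ltnS leq_eqVlt => /orP [/eqP -> {q}|qi] ti.
  rewrite /= !ep vi addn1; case: ltnP => [lt|]; last by lia.
  rewrite /= /upd /= !ep.
  by case: eqP => ?; last case: eqP => ?; lia.
have qk : (q < k)%N by lia.
have tp : (t < ptr i)%N.
  have := csr_ptr_mono ((csr_rows_csr _ _ _ _).2 csrD) (i := q.+1) (j := i).
  by case/andP: ti => _ tq /(_ _) h; apply: leq_trans tq (h _); rewrite qi ltnW.
have := Ii q t qi ti.
rewrite /= !ep vi addn1; case: ltnP => [lt|_ //].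
rewrite /= /upd /= !ep.
by rewrite !ifN //; apply/eqP; lia.
Qed.

Lemma run_link_columns s : has_input s -> iarr s 7 =1 (fun=> 0%N) ->
  runs M link_columns s (fun s' =>
    (forall j, last_cell idx j (ptr k) (iarr s' 7 j)) /\
    (forall t, (t < ptr k)%N -> last_cell idx (idx t) t (iarr s' 8 t))).
Proof.
move=> hs h0; apply: (runs_for (n := ptr k) (x := 2) (I := fun i s' =>
    (forall j, last_cell idx j i (iarr s' 7 j)) /\
    (forall t, (t < i)%N -> last_cell idx (idx t) t (iarr s' 8 t)))) => //;
  rewrite ?M_gt0 ?cells_M //.
- by split=> // j; rewrite /= h0; split.
- by move=> i s' /has_input_preserved /(_ isT hs) [/= -> _ -> _ _].
move=> i [iv ia ra] /has_input_preserved /(_ isT hs) [/= _ _ _ ei _] ik vi.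
case=> hP nP; rewrite /= /upd /= !ei vi; split=> [j|t].
  have [jb jq jm] := hP j; case: eqP => [->|/eqP ji].
    by rewrite addn1; split=> // t _; rewrite ltnS.
  split=> [||t]; [exact: leqW | exact: jq | rewrite ltnS leq_eqVlt].
  by case/orP=> [/eqP -> e|]; [rewrite e eqxx in ji | apply: jm].
rewrite ltnS leq_eqVlt; case: eqP => [-> _|_ /=]; last exact: nP.
exact: hP.
Qed.

Section Search.
Variables (mate head next : nat -> nat).
Hypotheses (mateP : mate_spec mate k)
  (headP : forall j, last_cell idx j (ptr k) (head j))
  (nextP : forall t, (t < ptr k)%N -> last_cell idx (idx t) t (next t)).

Definition search_state (s : state R) : Prop :=
  search_inv l (ptr k) idx mate val (ivar s 3) (ivar s 4) (ivar s 5) (ivar s 6)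
    (iarr s 9) (iarr s 10) (rarr s 3).

Definition state_potential (s : state R) : nat :=
  potential l (ptr k) idx (ivar s 3) (ivar s 4) (ivar s 6) (iarr s 10).

(** The potential is unchanged, as it does not see the part of the queue that is
    written.  *)
Lemma run_visit s e (w := ivar s 7) (v := ivar s 3) (s1 := run (visit e) s) :
  search_state s ->
  (iarr s 9 w = 0%N -> [/\ (w <= v < l)%N, reval s e = 1 \/ reval s e = -1 &
     (w = v /\ reval s e = 1) \/
     (iarr s 9 v = v.+1 /\ forall y, kernel (ptr k) idx mate val y ->
        y w = reval s e * y v)]) ->
  [/\ search_state s1, state_potential s1 = state_potential s,
      iarr s1 9 w != 0%N & forall q, iarr s 9 q != 0%N -> iarr s1 9 q != 0%N].
Proof.
move: @w @v @s1; case: s => iv ia ra w v s1 inv hw.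
rewrite {}/s1 {}/w {}/v /= in hw *.
case r0: (ia 9 (iv 7) == 0%N); last by split; rewrite //= r0.
have [wv e1 ev] := hw (eqP r0); rewrite !addn1; split.
- exact: (search_visit inv (eqP r0) wv e1 ev).
- exact/potential_upd/(si_hn inv).
- by rewrite /= /upd /= eqxx.
- by move=> q; rewrite /= /upd /=; case: (q == _).
Qed.

Lemma run_search s : has_input s ->
  iarr s 6 =1 mate -> iarr s 7 =1 head -> iarr s 8 =1 next ->
  iarr s 9 = (fun=> 0%N) -> ivar s 4 = 0%N -> ivar s 5 = 0%N -> ivar s 6 = 0%N ->
  runs M search s (fun s' =>
    (forall w, (w < l)%N ->
       labelled l (ptr k) idx mate val (iarr s' 9) (rarr s' 3) w) /\
    (forall t, (t < ptr k)%N ->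
       iarr s' 9 (idx (mate t)) = iarr s' 9 (idx t))).
Proof.
move=> hs e6 e7 e8 e9 h0 n0 c0; have tm := val_sign nbD csrD.
pose I (s' : state R) := [/\ search_state s', (ivar s' 3 <= l)%N &
  forall w, (ivar s' 3 <= w < l)%N -> iarr s' 9 w != 0%N].
have kv t : (t < ptr k)%N -> val t * val t = 1.
  by move=> /tm [->|->]; rewrite ?mulrNN mulr1.
have mN := mate_bound csrD mateP.
apply: (@runs_seq _ _ _ _ _ (fun s' => s' = run (Assign 3 (Var 1)) s)).
- exact: M_gt0.
- by apply: runs_loopfree => //; apply: M_gt0.
move=> s1 /has_input_preserved /(_ isT hs) hs1 es1.
have I1 : I s1.
  have [_ e1 _ _ _] := hs; rewrite es1 /I /search_state /= /upd /= e1 h0 n0 c0 e9.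
  by split=> [||w]; [exact: search_init | exact: leqnn | lia].
have post s' : I s' /\ ~~ teval s' (ILt (Cst 0)
      (IAdd (IAdd class_ (ISub queued_ taken_)) cell_)) ->
    (forall w, (w < l)%N ->
       labelled l (ptr k) idx mate val (iarr s' 9) (rarr s' 3) w) /\
    (forall t, (t < ptr k)%N ->
       iarr s' 9 (idx (mate t)) = iarr s' 9 (idx t)).
  case=> -[inv vl reached] /= stop; have hn := si_hn inv.
  have [v0 hn' cu0] : [/\ ivar s' 3 = 0, ivar s' 4 = ivar s' 5 & ivar s' 6 = 0]%N.
    by split; lia.
  apply: (search_done (cell_bound csrD) inv) => // w wl.
  by apply: reached; rewrite v0.
apply: (runs_conseq post).
apply: (runs_while (m := state_potential)) => //; first exact: M_gt0.
  rewrite es1 /state_potential /potential /= /upd /= h0.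
  have [_ -> _ _ _] := hs; have := count_size (predC (explored idx (iarr s 10) 0
    (ivar s 6))) (iota 0 (ptr k)); rewrite size_iota.
  by have := cells_le nbD csrD; rewrite /M; lia.
move=> s' ps' [inv vl reached] run_on; rewrite /= in run_on.
have [_ e1 _ ei ev] := has_input_preserved ps' isT hs1.
have em : iarr s' 6 =1 mate.
  by move=> t; have [_ -> // _] := ps'; rewrite es1 /= e6.
have eh : iarr s' 7 =1 head.
  by move=> t; have [_ -> // _] := ps'; rewrite es1 /= e7.
have en : iarr s' 8 =1 next.
  by move=> t; have [_ -> // _] := ps'; rewrite es1 /= e8.
case cp: (0 < ivar s' 6)%N.
  set e := RSub (RSub One One) (RMul (RMul (val_ cell_.-i) (val_ (mate_ cell_.-i)))
    (sign_ (idx_ cell_.-i))).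
  pose s2 := run (Assign 7 (idx_ (mate_ cell_.-i))) s'; pose s3 := run (visit e) s2.
  have -> : run search_step s' = run (Assign 6 (next_ cell_.-i)) s3.
    by rewrite /search_step /= cp.
  set t := (ivar s' 6).-1.
  have tk : (t < ptr k)%N by have := si_cur inv; rewrite /t; lia.
  have w2 : ivar s2 7 = idx (mate t) by rewrite /s2 /= /upd /= subn1 em ei.
  have re : reval s2 e = - (val t * val (mate t) * rarr s' 3 (idx t)).
    by rewrite /e /= /upd /= subn1 em ei !ev subrr sub0r.
  have ct := current_root inv cp.
  have [lt rr xs _ yk] : labelled l (ptr k) idx mate val (iarr s' 9) (rarr s' 3)
    (idx t) by apply: (si_label inv); rewrite ct.
  have [|inv3 pot3 rw3 mono] := @run_visit s2 e inv.
    rewrite w2 re => rw; rewrite ct /= in lt rr yk; split.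
    - have wl : (idx (mate t) < l)%N by apply: (cell_bound csrD); apply: mN.
      suff : ~~ (ivar s' 3 <= idx (mate t))%N by rewrite -[ivar s2 3]/(ivar s' 3); lia.
      by apply/negP=> vw; have := reached _ (introT andP (conj vw wl)); rewrite rw.
    (* Eight cases: the two entries of the row and the sign of the old column. *)
    - have := tm _ tk; have := tm _ (mN _ tk); move: xs.
      by do 3 case=> ->; rewrite ?(mulr1, mulrN, opprK); first [by left|by right].
    - right; split=> [//|y ky]; have := ky t tk; rewrite /cell_eq yk //.
      move/eqP; rewrite addr_eq0 => /eqP E.
      (* Solve the row equation for [y w], using [val (mate t) ^+ 2 = 1]. *)
      rewrite -[LHS]mul1r -(kv _ (mN _ tk)) -mulrA -[val (mate t) * y _]opprK -E.
      by rewrite mulrN mulNr mulrCA !mulrA.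
  have [pv pi _] := run_preserves (visit e) s2; rewrite -/s3 in inv3 pot3 rw3 mono pv pi.
  have c3 : ivar s3 6 = ivar s' 6 by rewrite pv.
  rewrite w2 in rw3.
  have mm := mateK csrD mateP.
  have [||inv4 pot4] := search_next mN mm nextP inv3.
  - by rewrite c3.
  - by rewrite c3.
  rewrite -/(state_potential s3) pot3 c3 in inv4 pot4.
  have e4 : iarr s3 8 (ivar s3 6 - 1)%N = next t.
    by rewrite c3 subn1 pi // en.
  split; last by rewrite /state_potential /= /upd /= e4.
  split.
  - by rewrite /search_state /= /upd /= e4.
  - by rewrite /= /upd /= pv.
  - by move=> w; rewrite /= /upd /= pv // => /reached /mono.
case hn: (ivar s' 4 < ivar s' 5)%N.
  have [||inv2 pot2] := search_pop headP inv; [lia | by [] |].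
  have -> : run search_step s' =
      run (Seq (Assign 6 (head_ (queue_ taken_))) (Assign 4 taken_.+i)) s'.
    by rewrite /search_step /= cp /= hn.
  split; last by rewrite /state_potential /= /upd /= eh addn1.
  split=> //.
  by rewrite /search_state /= /upd /= eh addn1.
pose s2 := run (Seq (Assign 3 class_.-i) (Assign 7 class_)) s'.
have -> : run search_step s' = run (visit One) s2.
  by rewrite /search_step /= cp /= hn.
have hle := si_hn inv.
have inv2 : search_state s2.
  rewrite /search_state /= /upd /=; apply: (search_close inv); lia.
have [v2 w2] : ivar s2 3 = (ivar s' 3).-1 /\ ivar s2 7 = (ivar s' 3).-1.
  by rewrite /= /upd /= subn1.
have [|inv3 pot3 rw3 mono] := run_visit (e := One) inv2.
  by move=> _; rewrite w2 v2; split; [lia | left | left].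
have [pv _ _] := run_preserves (visit One) s2.
split; last first.
  rewrite pot3 /state_potential v2 /= /upd /=.
  by rewrite /potential; lia.
split=> //; rewrite pv // v2; first by lia.
move=> w /andP []; rewrite leq_eqVlt => /orP [/eqP <- _|lt wl].
  by rewrite -w2.
by apply/mono/reached; lia.
Qed.

Section Labels.
Variables (root : nat -> nat) (x : nat -> R).
Hypotheses (labels : forall w, (w < l)%N ->
    labelled l (ptr k) idx mate val root x w)
  (root_mate : forall t, (t < ptr k)%N -> root (idx (mate t)) = root (idx t)).

(** Some row equation of the class with label [r] fails for the signs [x], among
    those of the first [m] cells.  *)
Definition unbalanced_class m r : bool :=
  has (fun t => (root (idx t) == r) && (cell_eq idx mate val x t != 0)) (iota 0 m).

Lemma unbalanced_classS m r : unbalanced_class m.+1 r =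
  unbalanced_class m r || (root (idx m) == r) && (cell_eq idx mate val x m != 0).
Proof. by rewrite /unbalanced_class -addn1 iotaD has_cat /= orbF. Qed.

Lemma run_mark_bad s : has_input s ->
  iarr s 6 =1 mate -> iarr s 9 =1 root -> rarr s 3 =1 x ->
  iarr s 11 =1 (fun=> 0%N) ->
  runs M mark_bad s (fun s' =>
    forall r, (iarr s' 11 r != 0%N) = unbalanced_class (ptr k) r).
Proof.
move=> hs e6 e9 e3 e11; apply: (runs_for (n := ptr k) (x := 2) (I := fun i s' =>
    forall r, (iarr s' 11 r != 0%N) = unbalanced_class i r)) => //;
  rewrite ?M_gt0 ?cells_M //.
- by move=> r; rewrite /= e11.
- by move=> i s' /has_input_preserved /(_ isT hs) [/= -> _ -> _ _].
move=> i [iv ia ra] ps ik /= vi Ii r.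
have [/= _ _ _ ei ev] := has_input_preserved ps isT hs.
have [/= _ pi pr] := ps.
have {}e6 t : ia 6 t = mate t by rewrite pi.
have {}e9 t : ia 9 t = root t by rewrite pi.
have {}e3 t : ra 3 t = x t by rewrite pr.
rewrite unbalanced_classS -Ii /=.
rewrite !ev !ei e6 !e3 vi e9 subrr /cell_eq.
set E := val i * x (idx i) + _; case: (E == 0) => /=; first by rewrite andbF orbF.
by rewrite /upd /= [r == _]eq_sym andbT; case: (root _ == r); rewrite ?orbT ?orbF.
Qed.

Definition class_name (i : 'I_l) : 'I_l := insubd i (root i).-1.

Lemma val_class_name i : class_name i = (root i).-1 :> nat.
Proof.
have [/andP [lt le] _ _ _ _] := labels (ltn_ord i).
by rewrite val_insubd; case: ifP => // /negbT; lia.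
Qed.

Lemma class_name_eq i m : (class_name i == m) = (root i == m.+1).
Proof.
have [/andP [lt _] _ _ _ _] := labels (ltn_ord i).
by rewrite -val_eqE /= val_class_name; lia.
Qed.

(** For [ker_sign], a column vector is extended by 0 to a function on all numbers,
    to which the cell equations and hence the labels apply.  *)
Lemma labels_signed_components : signed_components D class_name x.
Proof.
split.
- move=> r i j /(entry_cell csrD) [t tr ti] /(entry_cell csrD) [t' tr' tj].
  apply: val_inj; rewrite /= !val_class_name -ti -tj.
  have tk : (t < ptr k)%N.
    by case/andP: tr => _ h; apply: leq_trans h (ptr_le csrD (ltn_ord r)).
  by case: (row_cases nbD csrD mateP (ltn_ord r) tr tr') => ->; rewrite ?root_mate.
- move=> i; have [/andP [lt _] _ _ _ _] := labels (ltn_ord i).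
  by rewrite val_class_name; lia.
- move=> i; apply: val_inj; rewrite /= !val_class_name.
  by have [_ -> _ _ _] := labels (ltn_ord i).
- by move=> i; have [_ _ xs _ _] := labels (ltn_ord i).
- by move=> i; rewrite val_class_name; have [_ _ _ -> _] := labels (ltn_ord i).
- move=> y Dy i; pose yy q := if insub q is Some j then y j 0 else 0.
  have yyE (j : 'I_l) : yy j = y j 0 by rewrite /yy valK.
  have /(cells_kernel nbD csrD mateP) ky : D *m \col_j yy j = 0.
    by rewrite -[RHS]Dy; congr (_ *m _); apply/colP=> j; rewrite mxE yyE.
  have [_ _ _ _ yk] := labels (ltn_ord i).
  by have := yk yy ky; rewrite -val_class_name !yyE.
Qed.

Lemma balancedE (m : 'I_l) : balanced D class_name x m =
  (root m == m.+1) && ~~ unbalanced_class (ptr k) m.+1.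
Proof.
rewrite /balanced class_name_eq; congr (_ && _).
pose z q := if root q == m.+1 then x q else 0.
have -> : class_vector class_name x m = \col_q z q.
  by apply/colP=> q; rewrite !mxE class_name_eq.
have zE t : (t < ptr k)%N -> cell_eq idx mate val z t =
    if root (idx t) == m.+1 then cell_eq idx mate val x t else 0.
  move=> tk; rewrite /cell_eq /z root_mate //.
  by case: ifP => // _; rewrite !mulr0 addr0.
apply/eqP/hasPn => [/(cells_kernel nbD csrD mateP) kz t|none].
  rewrite mem_iota => /= tk; have := kz t tk; rewrite zE //.
  by case: ifP => //= _ ->; rewrite eqxx.
apply/(cells_kernel nbD csrD mateP) => t tk; rewrite zE //.
have := none t; rewrite mem_iota tk => /(_ isT); rewrite negb_and negbK.
by case: ifP => //= _ /eqP.
Qed.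

End Labels.
End Search.

Section Output.
Variables (root : 'I_l -> 'I_l) (x : 'I_l -> R).
Hypothesis rx : signed_components D root x.

Definition output_ready (s : state R) : Prop :=
  [/\ has_input s, forall j : 'I_l, iarr s 9 j = (root j).+1,
      forall j : 'I_l, rarr s 3 j = x j
    & forall j : 'I_l, (iarr s 9 j == j.+1) && (iarr s 11 j.+1 == 0%N) =
        balanced D root x j].

Lemma output_ready_preserved c s s' : preserves c s s' ->
  ~~ [|| sets_ivar c 0, sets_ivar c 1, sets_iarr c 0, sets_iarr c 1
       | sets_rarr c 0] ->
  ~~ [|| sets_iarr c 9, sets_iarr c 11 | sets_rarr c 3] ->
  output_ready s -> output_ready s'.
Proof.
move=> ps c1 c2 [hs h9 h3 hb]; split; first exact: has_input_preserved ps c1 hs.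
all: case: ps => _ pi pr; move: c2; rewrite !negb_or => /and3P [i9 i11 r3] j.
- by rewrite pi.
- by rewrite pr.
- by rewrite pi // pi // hb.
Qed.

Lemma run_copy_cell (A : 'M[R]_(k, l)) i w (s : state R) d (t := (ptr i + d)%N) :
  output_ready s -> (i < k)%N -> ivar s 2 = i ->
  csr_partial A i w (iarr s 2) (iarr s 3) (rarr s 1) (ivar s 8) ->
  let s' := run (copy_cell d) s in
  csr_partial A i
    (w ++ [seq (idx t, val t) | t <- [:: t] & (t < ptr i.+1)%N &&
             ~~ [exists j : 'I_l, (idx t == j) && balanced D root x j]])
    (iarr s' 2) (iarr s' 3) (rarr s' 1) (ivar s' 8).
Proof.
move=> [[_ _ ep ei ev] _ _ hb] ik vi hw /=; rewrite !ep !ei vi !addn1 -/t.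
case: ltnP => ti /=; last by rewrite cats0.
have tk : (t < ptr k)%N by apply: leq_trans ti (ptr_le csrD ik).
have tl := cell_bound csrD tk.
rewrite (hb (Ordinal tl)) /=.
have -> : [exists j : 'I_l, (idx t == j) && balanced D root x j] =
    balanced D root x (Ordinal tl).
  apply/existsP/idP => [[j /andP [/eqP tj]]|b]; last by exists (Ordinal tl); rewrite eqxx.
  by have -> : j = Ordinal tl by apply: val_inj.
case: ifP => _ /=; last by rewrite cats0.
by rewrite cats1 /upd /= !ep ev; apply: csr_emit.
Qed.

(** A row has at most two cells, so two calls of [copy_cell] cover it.  *)
Lemma filter_pair (p : pred nat) a b : (a <= b <= a + 2)%N ->
  [seq t <- [:: (a + 0)%N; (a + 1)%N] | (t < b)%N && p t] =
  [seq t <- index_iota a b | p t].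
Proof.
move=> ab; have [->|[->|->]] : b = a \/ b = a.+1 \/ b = a.+2 by lia.
- by rewrite /index_iota subnn /= addn0 addn1 !ltnNge leqnn leqnSn.
- by rewrite /index_iota subSnn /= addn0 addn1 ltnS leqnn ltnn.
- by rewrite /index_iota -addn2 addKn /= addn0 addn1 addn2 !ltnS leqnSn leqnn.
Qed.

Lemma run_write_product s : output_ready s -> iarr s 2 0 = 0%N ->
  runs M write_product s (fun s' =>
    is_csr (D *m reduction D root x) (iarr s' 2) (iarr s' 3) (rarr s' 1)).
Proof.
move=> hs z2; set A := D *m _.
apply: (runs_seq M_gt0 (P := fun s' => iarr s' 2 0 = 0%N /\ ivar s' 8 = 0%N)).
  by apply: runs_loopfree => //; exact: M_gt0.
move=> s1 /output_ready_preserved /(_ isT isT hs) hs1 [z21 out0].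
apply: (@runs_conseq _ _ _ _ (fun s' =>
    csr_rows A k (iarr s' 2) (iarr s' 3) (rarr s' 1) /\ ivar s' 8 = iarr s' 2 k)).
  by move=> s' [/csr_rows_csr].
apply: (runs_for (n := k) (x := 2) (I := fun i s' =>
    csr_rows A i (iarr s' 2) (iarr s' 3) (rarr s' 1) /\ ivar s' 8 = iarr s' 2 i))
  => //; rewrite ?M_gt0 /M //; first lia.
- by split; [apply: csr_rows0 | rewrite /= /upd /= out0 z21].
- by move=> i s' /output_ready_preserved /(_ isT isT hs1) [[/= -> _ _ _ _] _ _ _].
move=> i s' /output_ready_preserved /(_ isT isT hs1) hs2 ik vi [rows outi].
have := csr_rows_partial rows; rewrite -outi.
move=> /(run_copy_cell 0 hs2 ik vi); set s3 := run _ s'.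
have p3 : preserves (copy_cell 0) s' s3 by apply: run_preserves.
have vi3 : ivar s3 2 = i by case: p3 => -> // _ _.
have hs3 := output_ready_preserved p3 isT isT hs2.
move=> /(run_copy_cell 1 hs3 ik vi3); set s4 := run _ s3.
have vi4 : ivar s4 2 = i by have [-> //] := run_preserves (copy_cell 1) s3.
rewrite cat0s -map_cat -filter_cat filter_pair; last first.
  have [_ /(_ i ik) -> _ _ _] := csrD; have := row_size nbD csrD ik; lia.
set w := map _ _ => part.
suff rows4 : csr_rows A i.+1 (upd (iarr s4 2) i.+1 (ivar s4 8)) (iarr s4 3)
    (rarr s4 1).
  rewrite -[run _ _]/(run (Assign 2 i_.+i) (run (ISet 2 i_.+i out_) s4)).
  by rewrite /= /upd /= vi4 addn1; split=> //; rewrite eqxx.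
have [_ _ pu pv _] := csrD; apply: csr_close part _ _ _.
- rewrite -map_comp; apply: subseq_uniq (pu i ik).
  exact/map_subseq/filter_subseq.
- move=> c /mapP [t]; rewrite mem_filter mem_index_iota.
  move=> /andP [_ /andP [_ ti]] ->.
  by apply: pv; apply: leq_trans ti (ptr_le csrD ik).
move=> r j ri; rewrite (mul_reduction D root x) big_map big_filter_cond /=.
have nb t : idx t = j ->
    [exists q : 'I_l, (idx t == q) && balanced D root x q] = balanced D root x j.
  move=> ->; apply/existsP/idP => [[q /andP [/eqP /ord_inj ->]]//|b].
  by exists j; rewrite eqxx.
case: ifP => bj.
  by rewrite big_pred0 // => t; case: eqP => [/nb ->|]; rewrite ?bj ?andbF.
have [_ _ _ _ ->] := csrD; rewrite ri; apply: eq_bigl => t.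
by case: eqP => [/nb ->|]; rewrite ?bj ?andbF.
Qed.

Lemma run_write_reduction s : output_ready s -> iarr s 4 0 = 0%N ->
  runs M write_reduction s (fun s' =>
    is_csr (reduction D root x) (iarr s' 4) (iarr s' 5) (rarr s' 2)).
Proof.
move=> hs z4; set A := reduction D root x.
apply: (runs_seq M_gt0 (P := fun s' => iarr s' 4 0 = 0%N /\ ivar s' 8 = 0%N)).
  by apply: runs_loopfree => //; exact: M_gt0.
move=> s1 /output_ready_preserved /(_ isT isT hs) hs1 [z41 out0].
apply: (@runs_conseq _ _ _ _ (fun s' =>
    csr_rows A l (iarr s' 4) (iarr s' 5) (rarr s' 2) /\ ivar s' 8 = iarr s' 4 l)).
  by move=> s' [/csr_rows_csr].
apply: (runs_for (n := l) (x := 2) (I := fun i s' =>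
    csr_rows A i (iarr s' 4) (iarr s' 5) (rarr s' 2) /\ ivar s' 8 = iarr s' 4 i))
  => //; rewrite ?M_gt0 /M //; first lia.
- by split; [apply: csr_rows0 | rewrite /= /upd /= out0 z41].
- by move=> i s' /output_ready_preserved /(_ isT isT hs1) [[/= _ -> _ _ _] _ _ _].
move=> j' s' /output_ready_preserved /(_ isT isT hs1) [_ h9 h3 hb] jl vj [rows outj].
pose j := Ordinal jl; rewrite -[j']/(nat_of_ord j) in vj rows outj *.
pose w := (nat_of_ord j, 1) ::
  (if (root j != j) && balanced D root x (root j)
   then [:: (nat_of_ord (root j), x j)] else [::]).
pose row := Seq (emit 5 2 i_ One)
   (If (And (Not (IEq (root_ i_) i_.+i)) (IEq (bad_ (root_ i_)) (Cst 0)))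
       (emit 5 2 (root_ i_).-i (sign_ i_)) Skip).
set s4 := run row s'.
have vj4 : ivar s4 2 = j by have [-> //] := run_preserves row s'.
have part : csr_partial A j w (iarr s4 4) (iarr s4 5) (rarr s4 2) (ivar s4 8).
  have := csr_rows_partial rows; rewrite -outj => /(csr_emit j 1) p1.
  have eb : (iarr s' 9 j != j.+1) && (iarr s' 11 (iarr s' 9 j) == 0%N) =
      (root j != j) && balanced D root x (root j).
    by rewrite -hb !h9 (rootK rx) !eqSS eqxx.
  rewrite /s4 /w -eb /= /upd /= vj !addn1; case: ifP => _ /=.
    rewrite (h9 j : iarr s' 9 j' = _) (h3 j : rarr s' 3 j' = _) subn1.
    exact: (csr_emit (root j) (x j) p1).
  exact: p1.
suff rows4 : csr_rows A j.+1 (upd (iarr s4 4) j.+1 (ivar s4 8)) (iarr s4 5)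
    (rarr s4 2).
  rewrite -[run _ _]/(run (Assign 2 i_.+i) (run (ISet 4 i_.+i out_) s4)).
  by rewrite /= /upd /= vj4 addn1; split=> //; rewrite eqxx.
apply: csr_close part _ _ _.
- by rewrite /w; case: ifP => //= /andP [rj _]; rewrite inE eq_sym rj.
- move=> c; rewrite /w; case: ifP => _; rewrite !inE.
    by case/orP=> /eqP -> /=; rewrite ?ltn_ord ?oner_eq0 ?(sign_neq0 rx).
  by move/eqP=> ->; rewrite ltn_ord oner_eq0.
move=> i m /ord_inj ->; rewrite mxE class_vectorE /w.
have top : balanced D root x j -> root j = j by case/andP=> /eqP.
have xj : root j = j -> x j = 1 by move=> <-; apply: (sign_root rx).
rewrite big_cons /= -[j' == m]/(j == m).
case: (boolP ((root j != j) && _)) => [/andP [rj brj]|nb].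
  rewrite big_cons big_nil /= -[_ == _ :> nat]/(root j == m) addr0.
  have [em|jm] := eqVneq j m.
    rewrite -em (negbTE rj) addr0; case: ifP => // /top e.
    by rewrite e eqxx in rj.
  by have [<-|_] := eqVneq (root j) m; rewrite ?brj ?if_same //; case: ifP.
rewrite big_nil addr0; have [<-|jm] := eqVneq j m.
  by case: ifP => // /top e; rewrite e eqxx xj.
case: ifP => // bm; have [e|//] := eqVneq (root j) m.
by move: nb; rewrite e bm andbT negbK eq_sym (negbTE jm).
Qed.

End Output.

(** The component map depends on the storage of [D], so that it can only be
    known after the run.  *)
Lemma run_reduce : runs M reduce (input k l ptr idx val) (fun s =>
  exists root x, signed_components D root x /\
    output (D *m reduction D root x) (reduction D root x) s).
Proof.
set s0 := input _ _ _ _ _; have hs0 : has_input s0 by split.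
apply: (runs_seq M_gt0 (run_link_mates hs0)) => s1 p1 mateP.
have [v1 i1 r1] := p1; have hs1 := has_input_preserved p1 isT hs0.
have h7 : iarr s1 7 =1 (fun=> 0%N) by move=> t; rewrite i1.
apply: (runs_seq M_gt0 (run_link_columns hs1 h7)) => s2 p2 [headP nextP].
have [v2 i2 r2] := p2; have hs2 := has_input_preserved p2 isT hs1.
have e6 : iarr s2 6 =1 iarr s1 6 by move=> t; rewrite i2.
apply: (runs_seq M_gt0 (run_search mateP headP nextP hs2 e6 (fun=> erefl)
  (fun=> erefl) (etrans (i2 9 isT) (i1 9 isT))
  (etrans (v2 4 isT) (v1 4 isT)) (etrans (v2 5 isT) (v1 5 isT))
  (etrans (v2 6 isT) (v1 6 isT)))).
move=> s3 p3 [labels root_mate].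
have [v3 i3 r3] := p3; have hs3 := has_input_preserved p3 isT hs2.
have h6 : iarr s3 6 =1 iarr s1 6 by move=> t; rewrite i3 ?e6.
have h11 : iarr s3 11 =1 (fun=> 0%N) by move=> t; rewrite i3 ?i2 ?i1.
apply: (runs_seq M_gt0 (run_mark_bad (root := iarr s3 9) (x := rarr s3 3)
  hs3 h6 (fun=> erefl) (fun=> erefl) h11)) => s4 p4 bad.
have [v4 i4 r4] := p4; have hs4 := has_input_preserved p4 isT hs3.
have rx := labels_signed_components mateP labels root_mate.
pose x (j : 'I_l) := rarr s3 3 j.
have ready : output_ready (class_name (iarr s3 9)) x s4.
  split=> // j; rewrite ?r4 ?(i4 9%N) //.
    rewrite (val_class_name labels).
    by have [/andP [lt _] _ _ _ _] := labels j (ltn_ord j); lia.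
  by rewrite (balancedE mateP labels root_mate) -bad negbK.
have z2 : iarr s4 2 0 = 0%N by rewrite i4 ?i3 ?i2 ?i1.
apply: (runs_seq M_gt0 (run_write_product ready z2)) => s5 p5 csrR.
have [v5 i5 r5] := p5.
have z4 : iarr s5 4 0 = 0%N by rewrite i5 ?i4 ?i3 ?i2 ?i1.
have ready5 := output_ready_preserved p5 isT isT ready.
have [u [s6 [e lu p6 csrV]]] := run_write_reduction rx ready5 z4.
exists u, s6; split=> //; exists (class_name (iarr s3 9)), x; split=> //.
by have [_ i6 r6] := p6; split; rewrite // !i6 ?r6.
Qed.

End Phases.

Lemma inv_ackermann_gt0 l : (0 < inv_ackermann l)%N.
Proof. by rewrite /inv_ackermann; case: ex_minnP => m /andP []. Qed.

Theorem mainTheorem1 (R : realType) :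
  exists (c : prog) (C : nat),
  forall (k l : nat) (D : 'M[R]_(k, l)),
    non_branching D -> (forall j : 'I_l, col j D != 0) ->
  exists (Rd : 'M[R]_(k, l)) (V : 'M[R]_l),
    computes c D Rd V (C * (k * inv_ackermann l + l + 1))%N /\
    Rd = D *m V /\
    [/\ upper_triangular V /\ (forall i j : 'I_l, V i j \in [:: -1; 0; 1]),
        free (nonzero_columns Rd),
        forall i j : 'I_l, i != j ->
          (1 < #|supp (col i V)|)%N -> (1 < #|supp (col j V)|)%N ->
          [disjoint supp (col i V) & supp (col j V)]
      & forall i : 'I_l, (1 < #|supp (col i V)|)%N <-> col i Rd = 0].
Proof.
exists reduce, (unit_cost reduce) => k l D nbD D0.
have [ptr0 [idx0 [val0 csr0]]] := csr_exists D.
have [_ [_ [_ _ _ [root [x [rx _]]]]]] := run_reduce nbD csr0.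
exists (D *m reduction D root x), (reduction D root x); split; last split=> //.
  move=> ptr idx val csrD.
  have [u [s [e lu _ [root' [x' [rx' out]]]]]] := run_reduce nbD csrD.
  exists u, s; split=> //; last by rewrite (reduction_unique rx rx').
  apply: leq_trans lu _; rewrite leq_mul2l; apply/orP; right.
  by rewrite !leq_add2r leq_pmulr // inv_ackermann_gt0.
split.
- by split; [apply: reduction_upper | apply: reduction_entries].
- exact: reduction_free.
- exact: reduction_disjoint.
- move=> i; rewrite card_supp_reduction // col_mul_reduction.
  by case: ifP => //; split=> // /eqP; rewrite (negbTE (D0 i)).
Qed.
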